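(* Assume that $F$ satisfies (i)–(iv) of the context, that $A$ is coercive, i.e. there is $\nu>0$ with $\|A^{1/2}u\|^2\ge \nu\|u\|^2$ for all $u\in\mathcal H_1$, and that $\gamma(t)=\alpha/t$ with $\alpha>0$. Then for every sufficiently small $\varepsilon>0$ (i.e. there is $\varepsilon_0>0$ such that for every $\varepsilon\in(0,\varepsilon_0)$) the following holds. Let $t_1\ge t_0$ satisfy $$t_1^2\ge\max\left\{\frac{2\lambda}{\nu}|\alpha-1|,\ \frac{\lambda}{\nu}|3\lambda+1-\alpha|\right\}\quad\text{for both } \lambda=\frac{\alpha}{2}\text{ and }\lambda=\frac{\alpha}{2}+\varepsilon,$$ and let $t_{3,\varepsilon}>0$ be such that $$t_{3,\varepsilon}^2\ge\frac{(\frac{\alpha}{2}+\varepsilon)(1+2\varepsilon)}{2\nu\varepsilon}\,|\alpha-2-2\varepsilon|+t_1^2\qquad\text{and}\qquad t_{3,\varepsilon}\ge\frac{2\alpha|\alpha-2|}{\nu}+\sqrt{\frac{\alpha+2}{3\nu}}.$$ Then for every $(u_0,u_1)\in(\mathcal H_1\times\mathcal H)\setminus\{(0,0)\}$ there exists $t_4\ge t_{3,\varepsilon}$ such that the unique global mild solution $u$ of the Cauchy problem in the context satisfies $$\|u'(t)\|^2+\|A^{1/2}u(t)\|^2+F(u(t))\ \ge\ \frac{t_4^{-\alpha}}{4}\,t_0^{2\alpha}\,E(t_0)\,t^{-\alpha},\qquad\forall t\ge t_4.$$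
   Context: $\mathcal H$ is a real Hilbert space with scalar product $\langle\cdot,\cdot\rangle$ and norm $\|\cdot\|$; $A$ is a nonnegative self-adjoint operator on $\mathcal H$ with dense domain $D(A)$; $\mathcal H_1=D(A^{1/2})$ with norm $\|v\|_{\mathcal H_1}=(\|v\|^2+\|A^{1/2}v\|^2)^{1/2}$. Assumptions on $F$: (i) $F:\mathcal H_1\to\mathbb R$ is nonnegative and differentiable with $F(0)=0$, and its gradient is a map $\nabla F:\mathcal H_1\to\mathcal H$ (so $F'(u)h=\langle\nabla F(u),h\rangle$ for $u,h\in\mathcal H_1$). (ii) $\|\nabla F(v)-\nabla F(w)\|\le L_0(\|v\|_{\mathcal H_1},\|w\|_{\mathcal H_1})\|v-w\|_{\mathcal H_1}$ for all $v,w\in\mathcal H_1$, where $L_0$ is a positive function on $\mathbb R^+\times\mathbb R^+$ bounded on bounded sets. (iii) There is a constant $s>2$ with $sF(u)\le\langle\nabla F(u),u\rangle$ for all $u\in\mathcal H_1$. (iv) There is a constant $L_1>0$ such that, with the same $s$, $\|\nabla F(v)-\nabla F(w)\|\le L_1\|v-w\|_{\mathcal H_1}(\|v\|_{\mathcal H_1}^{s-2}+\|w\|_{\mathcal H_1}^{s-2})$ for all $v,w\in\mathcal H_1$. Cauchy problem: $u''(t)+Au(t)+\gamma(t)u'(t)+\nabla F(u(t))=0$ for $t\ge t_0$, $u(t_0)=u_0$, $u'(t_0)=u_1$, where $t_0>0$ and $\gamma(t)=\alpha/t$. A mild solution is $u\in C([t_0,\infty);\mathcal H_1)\cap C^1([t_0,\infty);\mathcal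 H)$ with $$u(t)=S'(t-t_0)u_0+S(t-t_0)u_1-\int_{t_0}^tS(t-\tau)[\gamma(\tau)u'(\tau)+\nabla F(u(\tau))]\,d\tau,$$ where $S(\cdot)$ is the solution operator of $u''+Au=0$ with $S(0)=0$, $S'(0)=I$. For each $(u_0,u_1)\in\mathcal H_1\times\mathcal H$ a unique global mild solution exists. Energy: $E(t)=\frac12\|u'(t)\|^2+\frac12\|A^{1/2}u(t)\|^2+F(u(t))$. *)

(* Defs.v *)
From Stdlib Require Import Reals.
From Coquelicot Require Import Coquelicot.
Open Scope R_scope.

Record Hilbert := {
  hilbert_sort :> CompleteNormedModule R_AbsRing;
  inner : hilbert_sort -> hilbert_sort -> R;
  inner_sym : forall x y, inner x y = inner y x;
  inner_plus : forall x y z, inner (plus x y) z = inner x z + inner y z;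
  inner_scal : forall (a : R) x y, inner (scal a x) y = a * inner x y;
  inner_norm : forall x, inner x x = norm x ^ 2
}.
Arguments inner {h} _ _.

(** A possibly unbounded operator is a domain together with a total function
    whose values outside the domain are never used. *)
Record Operator (H : Hilbert) := {
  dom : H -> Prop;
  app :> H -> H
}.
Arguments dom {H} _ _.
Arguments app {H} _ _.

Record linear_operator {H : Hilbert} (T : Operator H) : Prop := {
  dom_zero : dom T zero;
  dom_plus : forall x y, dom T x -> dom T y -> dom T (plus x y);
  dom_scal : forall (a : R) x, dom T x -> dom T (scal a x);
  app_plus : forall x y, dom T x -> dom T y -> T (plus x y) = plus (T x) (T y);
  app_scal : forall (a : R) x, dom T x -> T (scal a x) = scal a (T x)
}.

Definition densely_defined {H : Hilbert} (T : Operator H) : Prop :=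
  forall (x : H) (eps : R), 0 < eps ->
    exists y : H, dom T y /\ norm (minus x y) < eps.

(** [(x, z)] belongs to the graph of the adjoint of [T]. *)
Definition adjoint_graph {H : Hilbert} (T : Operator H) (x z : H) : Prop :=
  forall y : H, dom T y -> inner (T y) x = inner y z.

(** The last field is [T* = T], domains included. *)
Record self_adjoint {H : Hilbert} (T : Operator H) : Prop := {
  sa_linear : linear_operator T;
  sa_dense : densely_defined T;
  sa_adjoint : forall x z : H, adjoint_graph T x z <-> dom T x /\ T x = z
}.

Definition nonneg_operator {H : Hilbert} (T : Operator H) : Prop :=
  forall x : H, dom T x -> 0 <= inner (T x) x.

(** [B = T^(1/2)]: the (unique) nonnegative self-adjoint [B] with [B B = T],
    domains included. *)
Record is_sqrt_operator {H : Hilbert} (T B : Operator H) : Prop := {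
  sqrt_self_adjoint : self_adjoint B;
  sqrt_nonneg : nonneg_operator B;
  sqrt_dom : forall x : H, dom T x <-> dom B x /\ dom B (B x);
  sqrt_app : forall x : H, dom T x -> T x = B (B x)
}.

(** Below, [B] stands for [A^(1/2)] and [H_1] is [dom B] with this norm. *)
Definition norm1 {H : Hilbert} (B : Operator H) (v : H) : R :=
  sqrt (norm v ^ 2 + norm (B v) ^ 2).

(** [x ^ p] for [0 <= x] and [0 < p]; [Rpower 0 p] is [1]. *)
Definition rpow (x p : R) : R := if Req_EM_T x 0 then 0 else Rpower x p.

(** [F] and [gradF] are only constrained on [H_1 = dom B]. *)
Record nonlinearity {H : Hilbert} (B : Operator H) (s : R)
    (F : H -> R) (gradF : H -> H) : Prop := {
  F_nonneg : forall u, dom B u -> 0 <= F u;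
  F_zero : F zero = 0;
  F_diff : forall u, dom B u -> forall eps, 0 < eps ->
    exists delta, 0 < delta /\
      forall h, dom B h -> norm1 B h < delta ->
        Rabs (F (plus u h) - F u - inner (gradF u) h) <= eps * norm1 B h;
  gradF_lipschitz : exists L0 : R -> R -> R,
    (forall a b, 0 <= a -> 0 <= b -> 0 < L0 a b) /\
    (forall M, exists K, forall a b, 0 <= a <= M -> 0 <= b <= M -> L0 a b <= K) /\
    (forall v w, dom B v -> dom B w ->
       norm (minus (gradF v) (gradF w))
         <= L0 (norm1 B v) (norm1 B w) * norm1 B (minus v w));
  s_gt_2 : 2 < s;
  F_gradF : forall u, dom B u -> s * F u <= inner (gradF u) u;
  gradF_growth : exists L1 : R, 0 < L1 /\
    forall v w, dom B v -> dom B w ->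
      norm (minus (gradF v) (gradF w))
        <= L1 * norm1 B (minus v w)
           * (rpow (norm1 B v) (s - 2) + rpow (norm1 B w) (s - 2))
}.

Definition coercive {H : Hilbert} (B : Operator H) (nu : R) : Prop :=
  forall u : H, dom B u -> norm (B u) ^ 2 >= nu * norm u ^ 2.

(** [Sol t] is the bounded operator [S(t)] and [dSol t] its strong derivative
    [S'(t)].  For data in [H_1], [t |-> S(t) v] is a classical (that is, twice
    continuously differentiable) solution of [u'' + A u = 0]; since [H_1] is
    dense and each [S(t)] is bounded, this determines [S(t)] on [H]. *)
Record solution_operator {H : Hilbert} (A B : Operator H)
    (Sol dSol : R -> H -> H) : Prop := {
  Sol_bounded : forall t, is_linear (Sol t);
  Sol_derive : forall (v : H) (t : R),
    is_derive (fun r => Sol r v) t (dSol t v);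
  Sol_0 : forall v : H, Sol 0 v = zero;
  dSol_0 : forall v : H, dSol 0 v = v;
  Sol_dom : forall (v : H) (t : R), dom B v -> dom A (Sol t v);
  Sol_equation : forall (v : H) (t : R), dom B v ->
    is_derive (fun r => dSol r v) t (opp (A (Sol t v)));
  Sol_C2 : forall (v : H) (t : R), dom B v ->
    continuous (fun r => A (Sol r v)) t
}.

(** [du] is the derivative of [u] on [[t0, +oo)], one-sided at [t0]. *)
Record mild_solution {H : Hilbert} (B : Operator H) (gradF : H -> H)
    (Sol dSol : R -> H -> H) (alpha t0 : R) (u0 u1 : H)
    (u du : R -> H) : Prop := {
  mild_dom : forall t, t0 <= t -> dom B (u t);
  mild_continuous : forall t, t0 <= t ->
    filterlim (fun r => norm1 B (minus (u r) (u t)))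
      (within (fun r => t0 <= r) (locally t)) (locally 0);
  mild_derive : forall t, t0 <= t ->
    filterdiff u (within (fun r => t0 <= r) (locally t))
      (fun h : R => scal h (du t));
  mild_C1 : continuous_on (fun r => t0 <= r) du;
  mild_formula : forall t, t0 <= t ->
    u t = minus (plus (dSol (t - t0) u0) (Sol (t - t0) u1))
            (RInt (fun tau =>
               Sol (t - tau) (plus (scal (alpha / tau) (du tau)) (gradF (u tau))))
             t0 t)
}.

Definition energy {H : Hilbert} (B : Operator H) (F : H -> R)
    (u du : R -> H) (t : R) : R :=
  / 2 * norm (du t) ^ 2 + / 2 * norm (B (u t)) ^ 2 + F (u t).

(* Main.v *)
(** Since [t4] may depend on the data, it suffices to find [C > 0] depending only on
    the data such that [E(t) >= C t^(-alpha)] for large [t]: enlarging [t4] makes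
    the constant [t4^(-alpha)] of the statement as small as needed.

    The energy identity [E' = - (alpha / t) |u'|^2] and the derivative of [<u', u>]
    are obtained for the mild solution by regularizing its weak formulation with the
    resolvents [(1 + A / (n + 1))^(-1)], which are symmetric contractions commuting
    with [B], and letting [n] tend to infinity in the mean value theorem. For
    [G = E + alpha / (2 t) <u', u>], which is comparable to [E] by coercivity, the
    choice of the factor [alpha / 2] makes the kinetic and potential parts decay at
    the same rate:
      [G' = - (alpha / t) G + O(t^(-2)) E - (alpha / t) (<gradF u, u> / 2 - F u)].
    The last bracket is nonnegative because [s > 2], hence [E = O(t^(-alpha))]. The
    growth condition on [gradF] then bounds it by a multiple of [E^(s / 2)], that is by
    [E] times a negative power of [t], and integrating gives the lower bound. *)

Require Import Defs.
From Stdlib Require Import ssreflect Reals Lra Psatz Classical ClassicalEpsilon.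
From Coquelicot Require Import Coquelicot.
Open Scope R_scope.

(** * Inner products and derivatives *)

(** The obstacle is regularity. A mild solution is only $C^1$ in $H$: [u'] need not lie in $H_1$,
    and in general neither [u''] nor [A u] exists in $H$, so the terms that cancel in the energy
    identity have no separate meaning. The formula can only be differentiated after pairing with
    vectors of [dom A]; for this, the symmetry of $S(t)$, the bound $\|S(t)v\|\le|t|\|v\|$ and the
    commutation with [A] are derived from the differential equation by conservation laws. The
    resolvents then turn the weak equation into one that holds in norm, and since they are
    contractions, one modulus of continuity serves all of them in the limit.

    A second constraint is the order of quantifiers: [t4] is chosen before [u]. All constants are
    therefore computed from [alpha], [t0], [nu], the constants of [F] and $E(t_0)$, which is a
    function of [u0] and [u1]. The factor $E(t_0)$ survives because $E'\ge-(2\alpha/t)E$ gives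
    $E(T)\ge(t_0/T)^{2\alpha}E(t_0)$. *)

Lemma continuous_norm_eps {V : NormedModule R_AbsRing} (f : R -> V) (t : R) :
  continuous f t <->
  (forall eps, 0 < eps -> exists delta, 0 < delta /\
    forall r, Rabs (r - t) < delta -> norm (minus (f r) (f t)) < eps).
Proof.
  split.
  - intros Hc eps Heps.
    assert (Hl : locally (f t) (fun y => norm (minus y (f t)) < eps)).
    { apply locally_le_locally_norm. exists (mkposreal _ Heps). intros y Hy. exact Hy. }
    destruct (Hc _ Hl) as [d Hd]. exists d; split; [apply cond_pos|]. exact Hd.
  - intros Hc P HP. apply locally_norm_le_locally in HP. destruct HP as [e He].
    destruct (Hc e (cond_pos e)) as [d [Hd Hd']].
    exists (mkposreal _ Hd). intros r Hr. apply He, Hd', Hr.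
Qed.

Lemma is_derive_norm_eps {V : NormedModule R_AbsRing} (f : R -> V) (t : R) (l : V) :
  is_derive f t l <->
  (forall eps, 0 < eps -> exists delta, 0 < delta /\
    forall r, Rabs (r - t) < delta ->
      norm (minus (minus (f r) (f t)) (scal (r - t) l)) <= eps * Rabs (r - t)).
Proof.
  split.
  - intros [_ Hd] eps Heps.
    destruct (Hd t (fun P HP => HP) (mkposreal _ Heps)) as [d Hd'].
    exists d; split; [apply cond_pos|]. exact Hd'.
  - intros Hd. split; [apply is_linear_scal_l|].
    intros x Hx eps. apply (is_filter_lim_locally_unique (V := AbsRing_NormedModule R_AbsRing)) in Hx. subst x.
    destruct (Hd eps (cond_pos eps)) as [d [Hd1 Hd2]].
    exists (mkposreal _ Hd1). intros r Hr. apply Hd2, Hr.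
Qed.

Lemma continuous_H_eps {H : Hilbert} (f : R -> H) (t : R) :
  continuous f t <->
  (forall eps, 0 < eps -> exists delta, 0 < delta /\
    forall r, Rabs (r - t) < delta -> norm (minus (f r) (f t)) < eps).
Proof. exact (continuous_norm_eps f t). Qed.

Lemma is_derive_H_eps {H : Hilbert} (f : R -> H) (t : R) (l : H) :
  is_derive f t l <->
  (forall eps, 0 < eps -> exists delta, 0 < delta /\
    forall r, Rabs (r - t) < delta ->
      norm (minus (minus (f r) (f t)) (scal (r - t) l)) <= eps * Rabs (r - t)).
Proof. exact (is_derive_norm_eps f t l). Qed.

Lemma continuous_R_eps (f : R -> R) (t : R) :
  continuous f t <->
  (forall eps, 0 < eps -> exists delta, 0 < delta /\
    forall r, Rabs (r - t) < delta -> Rabs (f r - f t) < eps).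
Proof. exact (continuous_norm_eps (V := R_NormedModule) f t). Qed.

Lemma is_derive_R_eps (f : R -> R) (t l : R) :
  is_derive f t l <->
  (forall eps, 0 < eps -> exists delta, 0 < delta /\
    forall r, Rabs (r - t) < delta -> Rabs (f r - f t - (r - t) * l) <= eps * Rabs (r - t)).
Proof. exact (is_derive_norm_eps (V := R_NormedModule) f t l). Qed.

Lemma inner_plus_r {H : Hilbert} (x y z : H) : inner x (plus y z) = inner x y + inner x z.
Proof. rewrite inner_sym inner_plus (inner_sym _ y) (inner_sym _ z). reflexivity. Qed.

Lemma inner_scal_r {H : Hilbert} (a : R) (x y : H) : inner x (scal a y) = a * inner x y.
Proof. rewrite inner_sym inner_scal (inner_sym _ y). reflexivity. Qed.

Lemma inner_opp_l {H : Hilbert} (x y : H) : inner (opp x) y = - inner x y.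
Proof. 
  transitivity (inner (scal (opp 1) x) y).
  - f_equal. symmetry. apply (scal_opp_one x).
  - rewrite inner_scal. unfold opp; simpl. ring.
 Qed.

Lemma inner_opp_r {H : Hilbert} (x y : H) : inner x (opp y) = - inner x y.
Proof. rewrite inner_sym inner_opp_l inner_sym. reflexivity. Qed.

Lemma inner_minus_l {H : Hilbert} (x y z : H) : inner (minus x y) z = inner x z - inner y z.
Proof. rewrite inner_plus inner_opp_l. ring. Qed.

Lemma inner_minus_r {H : Hilbert} (x y z : H) : inner x (minus y z) = inner x y - inner x z.
Proof. rewrite inner_plus_r inner_opp_r. ring. Qed.

Lemma inner_zero_l {H : Hilbert} (x : H) : inner zero x = 0.
Proof. 
  transitivity (inner (scal 0 zero) x).
  - f_equal. symmetry. exact (scal_zero_r (K := R_AbsRing) (V := H) 0).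
  - rewrite inner_scal. ring.
 Qed.

Lemma inner_zero_r {H : Hilbert} (x : H) : inner x zero = 0.
Proof. rewrite inner_sym. apply inner_zero_l. Qed.

Ltac inner_expand :=
  rewrite
    ?(inner_minus_l, inner_minus_r, inner_opp_l, inner_opp_r, inner_zero_l, inner_zero_r, inner_plus, inner_plus_r, inner_scal, inner_scal_r).

Lemma inner_ge_0 {H : Hilbert} (x : H) : 0 <= inner x x.
Proof. rewrite inner_norm. apply pow2_ge_0. Qed.

Lemma norm_scal_H {H : Hilbert} (a : R) (x : H) : norm (scal a x) <= Rabs a * norm x.
Proof. apply (norm_scal a x). Qed.

Lemma norm_plus_H {H : Hilbert} (x y : H) : norm (plus x y) <= norm x + norm y.
Proof. apply (norm_triangle x y). Qed.

Lemma norm_pos_H {H : Hilbert} (x : H) : 0 <= norm x.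
Proof. apply (norm_ge_0 x). Qed.

Lemma cauchy_schwarz {H : Hilbert} (x y : H) : Rabs (inner x y) <= norm x * norm y.
Proof.
  assert (Hq : forall t, 0 <= norm x ^ 2 - 2 * t * inner x y + t ^ 2 * norm y ^ 2).
  { intros t. pose proof (inner_ge_0 (minus x (scal t y))) as Hp.
    revert Hp. inner_expand. rewrite (inner_sym _ y x) !inner_norm. intros Hp. nra. }
  pose proof (norm_ge_0 x) as Hx. pose proof (norm_ge_0 y) as Hy.
  apply Rsqr_incr_0; [|apply Rabs_pos|nra].
  rewrite -Rsqr_abs. unfold Rsqr.
  destruct (Req_dec (norm y) 0) as [Hy0|Hy0].
  - rewrite -> Hy0 in *. destruct (Req_dec (inner x y) 0) as [H0|H0]; [rewrite H0; lra|].
    (* For [norm y = 0] the quadratic is affine in [t]; this [t] would give it the value -1. *)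
    specialize (Hq ((norm x ^ 2 + 1) / (2 * inner x y))).
    replace (2 * ((norm x ^ 2 + 1) / (2 * inner x y)) * inner x y) with (norm x ^ 2 + 1) in Hq
      by (field; lra). nra.
  - specialize (Hq (inner x y / norm y ^ 2)).
    assert (Hp : 0 < norm y ^ 2) by (apply pow_lt; lra).
    replace (norm x ^ 2 - 2 * (inner x y / norm y ^ 2) * inner x y
      + (inner x y / norm y ^ 2) ^ 2 * norm y ^ 2)
      with ((norm x ^ 2 * norm y ^ 2 - inner x y ^ 2) / norm y ^ 2) in Hq by (field; lra).
    assert (0 <= norm x ^ 2 * norm y ^ 2 - inner x y ^ 2).
    { apply (Rmult_le_compat_r (norm y ^ 2)) in Hq; [|lra].
      unfold Rdiv in Hq. rewrite Rmult_assoc Rinv_l in Hq; lra. }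
    nra.
Qed.

Lemma inner_self_0 {H : Hilbert} (x : H) : inner x x = 0 -> x = zero.
Proof.
  rewrite inner_norm. intros Hx. apply (norm_eq_zero (K := R_AbsRing) (V := H)). pose proof (norm_ge_0 x). nra.
Qed.

Lemma inner_ext {H : Hilbert} (x y : H) : (forall z, inner x z = inner y z) -> x = y.
Proof.
  intros Hz. assert (H0 : minus x y = zero).
  { apply inner_self_0. rewrite inner_minus_l Hz. ring. }
  rewrite -(plus_zero_r y) -H0. unfold minus.
  rewrite (plus_comm x) plus_assoc plus_opp_r plus_zero_l. reflexivity.
Qed.

Lemma norm_le_of_inner {H : Hilbert} (x : H) (c : R) :
  0 <= c -> inner x x <= c * norm x -> norm x <= c.
Proof. rewrite inner_norm. intros Hc Hx. pose proof (norm_ge_0 x). nra. Qed.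

(** Testing against an arbitrary vector turns an identity between vectors into one between real
    numbers, where [ring] applies. *)
Ltac vec_ring :=
  apply inner_ext; intros ?; inner_expand; try ring.

Lemma norm_minus_sym {H : Hilbert} (x y : H) : norm (minus x y) = norm (minus y x).
Proof. replace (minus x y) with (opp (minus y x)) by vec_ring. apply (norm_opp (minus y x)). Qed.

Lemma norm_minus_le {H : Hilbert} (x y : H) : norm x <= norm y + norm (minus x y).
Proof.
  replace x with (plus y (minus x y)) at 1; [apply norm_plus_H|]. vec_ring.
Qed.

(** The quantity is a sum of products of norms rather than a difference of inner products, so that
    it still dominates after a contraction has been applied to all vectors. *)
Lemma product_close {H : Hilbert} (a b : H) (eps : R) : 0 < eps ->
  exists d, 0 < d /\ forall x y : H, norm (minus x a) < d -> norm (minus y b) < d ->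
    norm (minus x a) * norm y + norm a * norm (minus y b) < eps.
Proof.
  intros Heps.
  set (k := norm a + norm b + 1).
  assert (Hk : 0 < k) by (unfold k; pose proof (norm_pos_H a); pose proof (norm_pos_H b); lra).
  set (e := Rmin 1 (eps / (2 * k))).
  assert (He : 0 < e) by (apply Rmin_pos; [lra|apply Rdiv_lt_0_compat; lra]).
  assert (He1 : e <= 1) by apply Rmin_l.
  assert (He2 : e * k <= eps / 2).
  { replace (eps / 2) with (eps / (2 * k) * k) by (field; lra).
    apply Rmult_le_compat_r; [lra|apply Rmin_r]. }
  exists e. split; [exact He|]. intros x y Ha Hb.
  pose proof (norm_minus_le y b) as C3.
  pose proof (norm_pos_H a); pose proof (norm_pos_H b); pose proof (norm_pos_H y).
  pose proof (norm_pos_H (minus x a)); pose proof (norm_pos_H (minus y b)).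
  assert (D1 : norm (minus x a) * norm y <= e * (norm b + 1)) by (apply Rmult_le_compat; lra).
  assert (D2 : norm a * norm (minus y b) <= norm a * e) by (apply Rmult_le_compat; lra).
  unfold k in He2. lra.
Qed.

Lemma inner_close {H : Hilbert} (a b : H) (eps : R) : 0 < eps ->
  exists d, 0 < d /\ forall x y, norm (minus x a) < d -> norm (minus y b) < d ->
    Rabs (inner x y - inner a b) < eps.
Proof.
  intros Heps. destruct (product_close a b eps Heps) as [d [Hd Hc]].
  exists d. split; [exact Hd|]. intros x y Ha Hb. specialize (Hc x y Ha Hb).
  replace (inner x y - inner a b)
    with (inner (minus x a) y + inner a (minus y b)) by (inner_expand; ring).
  pose proof (cauchy_schwarz (minus x a) y). pose proof (cauchy_schwarz a (minus y b)).
  eapply Rle_lt_trans; [apply Rabs_triang|]. lra.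
Qed.

Lemma continuous_inner {H : Hilbert} (f g : R -> H) (t : R) :
  continuous f t -> continuous g t -> continuous (fun r => inner (f r) (g r)) t.
Proof.
  intros Hf Hg. apply continuous_R_eps. intros eps Heps.
  destruct (inner_close (f t) (g t) eps Heps) as [d [Hd Hc]].
  destruct (proj1 (continuous_H_eps f t) Hf d Hd) as [d1 [Hd1 H1]].
  destruct (proj1 (continuous_H_eps g t) Hg d Hd) as [d2 [Hd2 H2]].
  exists (Rmin d1 d2). split; [now apply Rmin_pos|]. intros r Hr.
  pose proof (Rmin_l d1 d2). pose proof (Rmin_r d1 d2).
  apply Hc; [apply H1|apply H2]; lra.
Qed.

Lemma is_derive_continuous {V : NormedModule R_AbsRing} (f : R -> V) (t : R) (l : V) :
  is_derive f t l -> continuous f t.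
Proof. intros Hd. apply (ex_derive_continuous f). exists l. exact Hd. Qed.

Ltac as_R_eq := match goal with |- @eq _ ?a ?b => change (@eq R a b) end.

Lemma is_derive_Rval (f : R -> R) (t l l' : R) : is_derive f t l -> l = l' -> is_derive f t l'.
Proof. now intros Hd <-. Qed.

Lemma is_derive_Rconst (c t : R) : is_derive (fun _ => c) t 0.
Proof. exact (is_derive_const c t). Qed.

Lemma is_derive_Rplus (f g : R -> R) (t a b : R) :
  is_derive f t a -> is_derive g t b -> is_derive (fun r => f r + g r) t (a + b).
Proof. intros Hf Hg. exact (is_derive_plus f g t a b Hf Hg). Qed.

Lemma is_derive_Rminus (f g : R -> R) (t a b : R) :
  is_derive f t a -> is_derive g t b -> is_derive (fun r => f r - g r) t (a - b).
Proof. intros Hf Hg. exact (is_derive_minus f g t a b Hf Hg). Qed.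

Lemma is_derive_Rscal (f : R -> R) (t a c : R) :
  is_derive f t a -> is_derive (fun r => c * f r) t (c * a).
Proof. intros Hf. exact (is_derive_scal f t c a Hf). Qed.

Lemma is_derive_Rmult (f g : R -> R) (t a b : R) :
  is_derive f t a -> is_derive g t b -> is_derive (fun r => f r * g r) t (a * g t + f t * b).
Proof. intros Hf Hg. exact (is_derive_mult f g t a b Hf Hg Rmult_comm). Qed.

(** Since [g] vanishes at [t], continuity of [f] is enough: replacing [f r] by [f t] costs
    $o(1)\cdot O(r-t)$. The product rule and the derivative of a quadratic form both reduce to this
    case. *)
Lemma is_derive_inner_vanish {H : Hilbert} (f g : R -> H) (t : R) (g' : H) :
  continuous f t -> is_derive g t g' -> g t = zero ->
  is_derive (fun r => inner (f r) (g r)) t (inner (f t) g').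
Proof.
  intros Hf Hg H0.
  pose proof (proj1 (continuous_H_eps f t) Hf) as Hf'.
  pose proof (proj1 (is_derive_H_eps g t g') Hg) as Hg'.
  apply is_derive_R_eps. intros eps Heps.
  set (k := norm (f t) + norm g' + 1).
  assert (Hk : 0 < k) by (unfold k; pose proof (norm_pos_H (f t)); pose proof (norm_pos_H g'); lra).
  set (e := Rmin 1 (eps / (2 * k))).
  assert (He : 0 < e) by (apply Rmin_pos; [lra|apply Rdiv_lt_0_compat; lra]).
  assert (He1 : e <= 1) by apply Rmin_l.
  assert (He2 : e * k <= eps / 2).
  { replace (eps / 2) with (eps / (2 * k) * k) by (field; lra).
    apply Rmult_le_compat_r; [lra|apply Rmin_r]. }
  destruct (Hf' e He) as [d1 [Hd1 H1]]. destruct (Hg' e He) as [d2 [Hd2 H2]].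
  exists (Rmin d1 d2). split; [apply Rmin_pos; assumption|]. intros r Hr.
  pose proof (Rmin_l d1 d2). pose proof (Rmin_r d1 d2).
  assert (Ha := H1 r ltac:(lra)). assert (Hb := H2 r ltac:(lra)). rewrite H0 in Hb.
  rewrite H0 inner_zero_r.
  set (y := minus (minus (g r) zero) (scal (r - t) g') : H).
  assert (Hy : norm y <= e * Rabs (r - t)) by exact Hb.
  replace (inner (f r) (g r) - 0 - (r - t) * inner (f t) g')
    with (inner (f r) y + (r - t) * inner (minus (f r) (f t)) g')
    by (unfold y; inner_expand; ring).
  pose proof (norm_minus_le (f r) (f t)) as C1.
  pose proof (cauchy_schwarz (f r) y) as C2.
  pose proof (cauchy_schwarz (minus (f r) (f t)) g') as C3.
  pose proof (norm_pos_H (f t)); pose proof (norm_pos_H g'); pose proof (norm_pos_H (f r)).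
  pose proof (norm_pos_H y); pose proof (norm_pos_H (minus (f r) (f t))).
  set (h := Rabs (r - t)) in *. assert (Hh : 0 <= h) by apply Rabs_pos.
  assert (D1 : Rabs (inner (f r) y) <= (norm (f t) + 1) * (e * h)).
  { eapply Rle_trans; [apply C2|]. apply Rmult_le_compat; lra. }
  assert (D2 : Rabs ((r - t) * inner (minus (f r) (f t)) g') <= h * (e * norm g')).
  { rewrite Rabs_mult. apply Rmult_le_compat; [apply Rabs_pos|apply Rabs_pos|apply Rle_refl|].
    eapply Rle_trans; [apply C3|]. apply Rmult_le_compat; lra. }
  eapply Rle_trans; [apply Rabs_triang|].
  assert (He3 : e * k * h <= eps * h) by (apply Rmult_le_compat_r; lra).
  assert (0 <= eps * h) by (apply Rmult_le_pos; lra).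
  unfold k in He3. lra.
Qed.

Lemma is_derive_inner {H : Hilbert} (f g : R -> H) (t : R) (f' g' : H) :
  is_derive f t f' -> is_derive g t g' ->
  is_derive (fun r => inner (f r) (g r)) t (inner f' (g t) + inner (f t) g').
Proof.
  intros Hf Hg.
  assert (Hm : forall (x : R -> H) (x' : H), is_derive x t x' -> is_derive (fun r => minus (x r) (x t)) t x').
  { intros x x' Hx. replace x' with (minus x' zero) by vec_ring.
    apply (is_derive_minus x (fun _ => x t)); [exact Hx|apply (is_derive_const (x t) t)]. }
  (* With increments at [t], $\langle f,g\rangle=\langle f,g-g(t)\rangle+\langle
     g(t),f-f(t)\rangle+\langle f(t),g(t)\rangle$. *)
  pose proof (is_derive_inner_vanish f (fun r => minus (g r) (g t)) t g'
    (is_derive_continuous _ _ _ Hf) (Hm g g' Hg) ltac:(vec_ring)) as D1.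
  pose proof (is_derive_inner_vanish (fun _ => g t) (fun r => minus (f r) (f t)) t f'
    (continuous_const _ _) (Hm f f' Hf) ltac:(vec_ring)) as D2.
  pose proof (is_derive_Rplus _ _ _ _ _ (is_derive_Rplus _ _ _ _ _ D2 D1)
    (is_derive_Rconst (inner (f t) (g t)) t)) as D3.
  apply (is_derive_ext _ (fun r => inner (f r) (g r))) in D3.
  - apply (is_derive_Rval _ _ _ _ D3). rewrite (inner_sym _ (g t) f'). ring.
  - intros r. as_R_eq. inner_expand. rewrite (inner_sym _ (g t) (f r)) (inner_sym _ (g t) (f t)). ring.
Qed.

Lemma is_derive_inner_l {H : Hilbert} (f : R -> H) (t : R) (f' z : H) :
  is_derive f t f' -> is_derive (fun r => inner (f r) z) t (inner f' z).
Proof.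
  intros Hf. pose proof (is_derive_inner f (fun _ => z) t f' zero Hf (is_derive_const z t)) as Hd.
  rewrite inner_zero_r Rplus_0_r in Hd. exact Hd.
Qed.

(** * Self-adjoint operators *)

Lemma self_adjoint_sym {H : Hilbert} (T : Operator H) (hT : self_adjoint T) (x y : H) :
  dom T x -> dom T y -> inner (T x) y = inner x (T y).
Proof. intros Hx Hy. exact (proj2 (sa_adjoint _ hT y (T y)) (conj Hy eq_refl) x Hx). Qed.

Lemma dom_minus {H : Hilbert} (T : Operator H) (hT : linear_operator T) (x y : H) :
  dom T x -> dom T y -> dom T (minus x y) /\ T (minus x y) = minus (T x) (T y).
Proof.
  intros Hx Hy. replace (minus x y) with (plus x (scal (-1) y)) by vec_ring.
  pose proof (dom_scal _ hT (-1) y Hy) as Hs. split; [apply dom_plus; assumption|].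
  rewrite app_plus; try assumption. rewrite app_scal; try assumption. vec_ring.
Qed.

Lemma app_zero {H : Hilbert} (T : Operator H) (hT : linear_operator T) : T zero = zero.
Proof.
  replace (@zero (CompleteNormedModule.AbelianMonoid R_AbsRing H)) with (scal 0 (zero : H)) at 1 by vec_ring.
  rewrite app_scal; [|assumption|]; [vec_ring|]. apply dom_zero; assumption.
Qed.

Lemma dense_eq_0 {H : Hilbert} (T : Operator H) (hT : densely_defined T) (g : H -> R) (C : R) :
  (forall x y, g (minus x y) = g x - g y) -> (forall x, Rabs (g x) <= C * norm x) ->
  (forall y, dom T y -> g y = 0) -> forall x, g x = 0.
Proof.
  intros Hg HC H0 x. destruct (Req_dec (g x) 0) as [Hx|Hx]; [assumption|exfalso].
  assert (Hp : 0 < Rabs (g x)) by now apply Rabs_pos_lt.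
  assert (HC0 : 0 <= Rabs C) by apply Rabs_pos.
  (* With [y] this close, [Rabs (g x) = Rabs (g (minus x y)) <= C * norm (minus x y)] would be
     smaller than [Rabs (g x)]. *)
  destruct (hT x (Rabs (g x) / (Rabs C + 1))) as [y [Hy Hxy]].
  { apply Rdiv_lt_0_compat; lra. }
  specialize (HC (minus x y)). rewrite Hg (H0 y Hy) Rminus_0_r in HC.
  pose proof (norm_pos_H (minus x y)). pose proof (Rle_abs C).
  assert (norm (minus x y) * (Rabs C + 1) < Rabs (g x)).
  { apply (Rmult_lt_compat_r (Rabs C + 1)) in Hxy; [|lra].
    replace (Rabs (g x) / (Rabs C + 1) * (Rabs C + 1)) with (Rabs (g x)) in Hxy by (field; lra). lra. }
  nra.
Qed.

Lemma dense_orthogonal {H : Hilbert} (T : Operator H) (hT : densely_defined T) (x : H) :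
  (forall y, dom T y -> inner x y = 0) -> x = zero.
Proof.
  intros H0. apply inner_self_0. apply (dense_eq_0 T hT (fun z => inner x z) (norm x)).
  - intros y z. apply inner_minus_r.
  - intros y. apply cauchy_schwarz.
  - exact H0.
Qed.

Lemma dense_inner_ext {H : Hilbert} (T : Operator H) (hT : densely_defined T) (x z : H) :
  (forall y, dom T y -> inner x y = inner z y) -> x = z.
Proof.
  intros H0. assert (Hm : minus x z = zero).
  { apply (dense_orthogonal T hT). intros y Hy. rewrite inner_minus_l H0; [lra|exact Hy]. }
  replace x with (plus z (minus x z)) by vec_ring. rewrite Hm. vec_ring.
Qed.

Lemma linear_map_minus {H : Hilbert} (l : H -> H) (hl : is_linear l) (x y : H) :
  l (minus x y) = minus (l x) (l y).
Proof.
  replace (minus x y) with (plus x (scal (-1) y)) by vec_ring.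
  rewrite (linear_plus l hl x). rewrite (linear_scal l hl (-1) y). vec_ring.
Qed.

Lemma const_of_derive_0 (h : R -> R) :
  (forall t, is_derive h t 0) -> forall a b, h a = h b.
Proof.
  intros Hd a b. destruct (Rtotal_order a b) as [Hab|[Hab|Hab]].
  - apply (eq_is_derive (V := R_NormedModule) h a b); [intros; apply Hd|exact Hab].
  - now subst.
  - symmetry. apply (eq_is_derive (V := R_NormedModule) h b a); [intros; apply Hd|exact Hab].
Qed.

Lemma continuous_reflect {H : Hilbert} (k : R -> H) (T r : R) :
  continuous k (T - r) -> continuous (fun x => k (T - x)) r.
Proof.
  intros Hk. apply (continuous_comp (fun x => T - x) k); [|exact Hk].
  apply (continuous_minus (fun _ => T) (fun x => x)); [apply continuous_const|apply continuous_id].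
Qed.

Lemma is_derive_reflect {H : Hilbert} (k : R -> H) (T r : R) (l : H) :
  is_derive k (T - r) l -> is_derive (fun x => k (T - x)) r (opp l).
Proof.
  intros Hk. replace (opp l) with (scal (-1) l) by vec_ring.
  apply (is_derive_comp k (fun x => T - x)); [exact Hk|].
  auto_derive; [exact I|ring].
Qed.

Lemma is_derive_shift {H : Hilbert} (k : R -> H) (T r : R) (l : H) :
  is_derive k (r - T) l -> is_derive (fun x => k (x - T)) r l.
Proof.
  intros Hk. replace l with (scal 1 l) by vec_ring.
  apply (is_derive_comp k (fun x => x - T)); [exact Hk|].
  auto_derive; [exact I|ring].
Qed.

(** * The solution operator *)

(** [T (x r)] need not be differentiable. By symmetry the increment of the form is $\langle
    Tx(r)+Tx(t),\,x(r)-x(t)\rangle$, whose second factor vanishes at [t] and whose first is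
    continuous. *)
Lemma is_derive_quadratic {H : Hilbert} (T : Operator H) (hT : self_adjoint T)
    (x : R -> H) (t : R) (x' : H) :
  (forall r, dom T (x r)) -> is_derive x t x' -> continuous (fun r => T (x r)) t ->
  is_derive (fun r => inner (T (x r)) (x r)) t (2 * inner (T (x t)) x').
Proof.
  intros Hdom Hx Hc.
  assert (Hd : is_derive (fun r => inner (plus (T (x r)) (T (x t))) (minus (x r) (x t))) t
    (inner (plus (T (x t)) (T (x t))) x')).
  { apply (is_derive_inner_vanish (fun r => plus (T (x r)) (T (x t))) (fun r => minus (x r) (x t))).
    - apply (continuous_plus (fun r => T (x r)) (fun _ => T (x t))); [exact Hc|apply continuous_const].
    - replace x' with (minus x' zero) by vec_ring.
      apply (is_derive_minus x (fun _ => x t)); [exact Hx|apply (is_derive_const (x t) t)].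
    - vec_ring. }
  pose proof (is_derive_Rplus _ (fun _ => inner (T (x t)) (x t)) _ _ _ Hd
    (is_derive_Rconst (inner (T (x t)) (x t)) t)) as Hs.
  apply (is_derive_ext _ (fun r => inner (T (x r)) (x r))) in Hs.
  - apply (is_derive_Rval _ _ _ _ Hs). inner_expand. ring.
  - intros r. inner_expand.
    rewrite (self_adjoint_sym T hT (x r) (x t)); try apply Hdom.
    rewrite (inner_sym _ (x r) (T (x t))). as_R_eq. ring.
Qed.

(** Conservation of energy for $u''+Au=0$, with $\langle Au,u\rangle$ as potential part, so that
    [Sol_C2] is all that has to be known about [A (Sol r v)]. *)
Lemma Sol_energy {H : Hilbert} (A B : Operator H) (Sol dSol : R -> H -> H)
    (hA : self_adjoint A) (hS : solution_operator A B Sol dSol) (v : H) (t : R) : dom B v ->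
  inner (dSol t v) (dSol t v) + inner (A (Sol t v)) (Sol t v) = inner v v.
Proof.
  intros Hv.
  transitivity (inner (dSol 0 v) (dSol 0 v) + inner (A (Sol 0 v)) (Sol 0 v)).
  2: { rewrite (dSol_0 _ _ _ _ hS) (Sol_0 _ _ _ _ hS) inner_zero_r. ring. }
  apply (const_of_derive_0 (fun r => inner (dSol r v) (dSol r v) + inner (A (Sol r v)) (Sol r v))).
  intros r.
  pose proof (Sol_equation _ _ _ _ hS v r Hv) as H1.
  pose proof (is_derive_inner _ _ r _ _ H1 H1) as H2.
  pose proof (is_derive_quadratic A hA (fun r => Sol r v) r (dSol r v)
    (fun r => Sol_dom _ _ _ _ hS v r Hv) (Sol_derive _ _ _ _ hS v r) (Sol_C2 _ _ _ _ hS v r Hv)) as H3.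
  apply (is_derive_Rval _ _ _ _ (is_derive_Rplus _ _ _ _ _ H2 H3)).
  simpl. inner_expand.
  rewrite (inner_sym _ (dSol r v) (A (Sol r v))). ring.
Qed.

Lemma dSol_contraction_dom {H : Hilbert} (A B : Operator H) (Sol dSol : R -> H -> H)
    (hA : self_adjoint A) (hA0 : nonneg_operator A) (hS : solution_operator A B Sol dSol)
    (v : H) (t : R) : dom B v -> norm (dSol t v) <= norm v.
Proof.
  intros Hv. pose proof (Sol_energy A B Sol dSol hA hS v t Hv) as He.
  pose proof (hA0 _ (Sol_dom _ _ _ _ hS v t Hv)) as Hp. rewrite !inner_norm in He.
  pose proof (norm_pos_H (dSol t v)). pose proof (norm_pos_H v). nra.
Qed.

(** On [dom B] the mean value theorem applies to $\langle S(r)w,z\rangle$, whose derivative is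
    controlled because $S'(r)$ is a contraction there. Density extends the bound to all vectors. *)
Lemma Sol_bound {H : Hilbert} (A B : Operator H) (Sol dSol : R -> H -> H)
    (hA : self_adjoint A) (hA0 : nonneg_operator A) (hB : is_sqrt_operator A B)
    (hS : solution_operator A B Sol dSol)
    (v : H) (t : R) : norm (Sol t v) <= Rabs t * norm v.
Proof.
  assert (Hdom : forall w z, dom B w -> Rabs (inner (Sol t w) z) <= Rabs t * norm w * norm z).
  { intros w z Hw.
    destruct (MVT_gen (fun r => inner (Sol r w) z) 0 t (fun r => inner (dSol r w) z)) as [c [_ Hc]].
    - intros x _. apply is_derive_inner_l, (Sol_derive _ _ _ _ hS).
    - intros x _. apply continuity_pt_filterlim.
      apply (is_derive_continuous (V := R_NormedModule) (fun r => inner (Sol r w) z) x (inner (dSol x w) z)).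
      apply is_derive_inner_l, (Sol_derive _ _ _ _ hS).
    - rewrite (Sol_0 _ _ _ _ hS) inner_zero_l !Rminus_0_r in Hc. rewrite Hc Rabs_mult.
      pose proof (cauchy_schwarz (dSol c w) z) as C1.
      pose proof (dSol_contraction_dom A B Sol dSol hA hA0 hS w c Hw) as C2.
      pose proof (norm_pos_H z). pose proof (Rabs_pos t). pose proof (norm_pos_H w).
      assert (norm (dSol c w) * norm z <= norm w * norm z) by (apply Rmult_le_compat_r; assumption).
      replace (Rabs t * norm w * norm z) with (norm w * norm z * Rabs t) by ring.
      apply Rmult_le_compat_r; lra. }
  assert (Hb : forall w, dom B w -> norm (Sol t w) <= Rabs t * norm w).
  { intros w Hw. apply norm_le_of_inner.
    - apply Rmult_le_pos; [apply Rabs_pos|apply norm_pos_H].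
    - eapply Rle_trans; [apply Rle_abs|]. apply Hdom, Hw. }
  destruct (linear_norm _ (Sol_bounded _ _ _ _ hS t)) as [M [HM0 HM]].
  apply Rle_plus_epsilon. intros eps Heps.
  pose proof (Rabs_pos t).
  (* Replacing [v] by [w] costs [M * norm (minus v w)] through the operator norm of [Sol t], and
     [Rabs t * norm (minus v w)] through the bound at [w]. *)
  destruct (sa_dense _ (sqrt_self_adjoint _ _ hB) v (eps / (M + Rabs t))) as [w [Hw Hvw]].
  { apply Rdiv_lt_0_compat; lra. }
  pose proof (norm_minus_le (Sol t v) (Sol t w)) as C1.
  rewrite -(linear_map_minus (Sol t) (Sol_bounded _ _ _ _ hS t)) in C1.
  pose proof (HM (minus v w)) as C2. specialize (Hb w Hw).
  pose proof (norm_minus_le w v) as C3. rewrite norm_minus_sym in C3.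
  assert (C4 : norm (minus v w) * (M + Rabs t) < eps).
  { apply (Rmult_lt_compat_r (M + Rabs t)) in Hvw; [|lra].
    replace (eps / (M + Rabs t) * (M + Rabs t)) with eps in Hvw by (field; lra). exact Hvw. }
  assert (C5 : Rabs t * norm w <= Rabs t * (norm v + norm (minus v w))) by (apply Rmult_le_compat_l; lra).
  change (norm (Sol t (minus v w)) <= M * norm (minus v w)) in C2.
  lra.
Qed.

Lemma Sol_sym_dom {H : Hilbert} (A B : Operator H) (Sol dSol : R -> H -> H)
    (hA : self_adjoint A) (hS : solution_operator A B Sol dSol) (v w : H) (t : R) :
  dom B v -> dom B w -> inner (Sol t v) w = inner v (Sol t w).
Proof.
  intros Hv Hw.
  (* A Wronskian of the solutions $S(r)v$ and $S(t-r)w$: it is constant because [A] is symmetric,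
     and its values at [t] and at 0 are the two sides of the claim. *)
  set (h := fun r => inner (Sol r v) (dSol (t - r) w) + inner (dSol r v) (Sol (t - r) w)).
  assert (Hc : h t = h 0).
  { apply const_of_derive_0. intros r. unfold h.
    pose proof (is_derive_inner _ _ r _ _ (Sol_derive _ _ _ _ hS v r)
      (is_derive_reflect _ _ _ _ (Sol_equation _ _ _ _ hS w (t - r) Hw))) as H1.
    pose proof (is_derive_inner _ _ r _ _ (Sol_equation _ _ _ _ hS v r Hv)
      (is_derive_reflect _ _ _ _ (Sol_derive _ _ _ _ hS w (t - r)))) as H2.
    apply (is_derive_Rval _ _ _ _ (is_derive_Rplus _ _ _ _ _ H1 H2)).
    simpl. inner_expand.
    rewrite (self_adjoint_sym A hA (Sol r v) (Sol (t - r) w)); try apply (Sol_dom _ _ _ _ hS); try assumption.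
    ring. }
  unfold h in Hc. rewrite Rminus_diag Rminus_0_r !(Sol_0 _ _ _ _ hS) !(dSol_0 _ _ _ _ hS) in Hc.
  rewrite inner_zero_l inner_zero_r in Hc. lra.
Qed.

(** Density is used twice, once for each argument; [Sol_bound] supplies the bound on the
    functionals. *)
Lemma Sol_sym {H : Hilbert} (A B : Operator H) (Sol dSol : R -> H -> H)
    (hA : self_adjoint A) (hA0 : nonneg_operator A) (hB : is_sqrt_operator A B)
    (hS : solution_operator A B Sol dSol) (v w : H) (t : R) :
  inner (Sol t v) w = inner v (Sol t w).
Proof.
  assert (Hg : forall a b x : H, Rabs (inner a x - inner b (Sol t x)) <= (norm a + norm b * Rabs t) * norm x).
  { intros a b x. pose proof (cauchy_schwarz a x). pose proof (cauchy_schwarz b (Sol t x)).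
    pose proof (Sol_bound A B Sol dSol hA hA0 hB hS x t).
    assert (norm b * norm (Sol t x) <= norm b * (Rabs t * norm x))
      by (apply Rmult_le_compat_l; [apply norm_pos_H|assumption]).
    unfold Rminus. eapply Rle_trans; [apply Rabs_triang|]. rewrite Rabs_Ropp. lra. }
  pose proof (sa_dense _ (sqrt_self_adjoint _ _ hB)) as hd.
  assert (H1 : forall a, dom B a -> forall x, inner (Sol t a) x - inner a (Sol t x) = 0).
  { intros a Ha. apply (dense_eq_0 B hd (fun x => inner (Sol t a) x - inner a (Sol t x))
      (norm (Sol t a) + norm a * Rabs t)).
    - intros x y. rewrite (linear_map_minus _ (Sol_bounded _ _ _ _ hS t)). inner_expand. ring.
    - intros x. apply Hg.
    - intros y Hy. rewrite (Sol_sym_dom A B Sol dSol hA hS a y t Ha Hy). ring. }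
  assert (H2 : inner (Sol t w) v - inner w (Sol t v) = 0).
  { apply (dense_eq_0 B hd (fun x => inner (Sol t w) x - inner w (Sol t x))
      (norm (Sol t w) + norm w * Rabs t)).
    - intros x y. rewrite (linear_map_minus _ (Sol_bounded _ _ _ _ hS t)). inner_expand. ring.
    - intros x. apply Hg.
    - intros y Hy. specialize (H1 y Hy w). rewrite (inner_sym _ (Sol t w) y) (inner_sym _ w). lra. }
  rewrite (inner_sym _ (Sol t v) w) (inner_sym _ v). lra.
Qed.

Lemma dSol_sym {H : Hilbert} (A B : Operator H) (Sol dSol : R -> H -> H)
    (hA : self_adjoint A) (hA0 : nonneg_operator A) (hB : is_sqrt_operator A B)
    (hS : solution_operator A B Sol dSol) (v w : H) (t : R) :
  inner (dSol t v) w = inner v (dSol t w).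
Proof.
  pose proof (is_derive_inner_l _ t _ w (Sol_derive _ _ _ _ hS v t)) as H1.
  pose proof (is_derive_inner_l _ t _ v (Sol_derive _ _ _ _ hS w t)) as H2.
  rewrite (inner_sym _ v). rewrite -(is_derive_unique _ _ _ H1) -(is_derive_unique _ _ _ H2).
  apply Derive_ext. intros r. rewrite (Sol_sym A B Sol dSol hA hA0 hB hS v w r). apply inner_sym.
Qed.

Lemma A_Sol_sym {H : Hilbert} (A B : Operator H) (Sol dSol : R -> H -> H)
    (hA : self_adjoint A) (hA0 : nonneg_operator A) (hB : is_sqrt_operator A B)
    (hS : solution_operator A B Sol dSol) (v w : H) (t : R) :
  dom B v -> dom B w -> inner (A (Sol t v)) w = inner v (A (Sol t w)).
Proof.
  intros Hv Hw.
  pose proof (is_derive_inner_l _ t _ w (Sol_equation _ _ _ _ hS v t Hv)) as H1.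
  pose proof (is_derive_inner_l _ t _ v (Sol_equation _ _ _ _ hS w t Hw)) as H2.
  assert (He : inner (opp (A (Sol t v))) w = inner (opp (A (Sol t w))) v).
  { rewrite -(is_derive_unique _ _ _ H1) -(is_derive_unique _ _ _ H2).
    apply Derive_ext. intros r. rewrite (dSol_sym A B Sol dSol hA hA0 hB hS v w r). apply inner_sym. }
  rewrite !inner_opp_l in He. rewrite (inner_sym _ v). lra.
Qed.

(** Two time derivatives of the symmetry of $S(t)$ make $AS(t)$ symmetric. For [y] in [dom A] this
    gives $\langle AS(t)v,y\rangle=\langle v,AS(t)y\rangle=\langle Av,S(t)y\rangle=\langle
    S(t)Av,y\rangle$. *)
Lemma A_Sol_comm {H : Hilbert} (A B : Operator H) (Sol dSol : R -> H -> H)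
    (hA : self_adjoint A) (hA0 : nonneg_operator A) (hB : is_sqrt_operator A B)
    (hS : solution_operator A B Sol dSol) (v : H) (t : R) :
  dom A v -> A (Sol t v) = Sol t (A v).
Proof.
  intros Hv. pose proof (proj1 (proj1 (sqrt_dom _ _ hB v) Hv)) as HvB.
  apply (dense_inner_ext A (sa_dense _ hA)). intros y Hy.
  pose proof (proj1 (proj1 (sqrt_dom _ _ hB y) Hy)) as HyB.
  rewrite (A_Sol_sym A B Sol dSol hA hA0 hB hS); try assumption.
  rewrite (Sol_sym A B Sol dSol hA hA0 hB hS).
  symmetry. apply (self_adjoint_sym A hA); [assumption|].
  apply (Sol_dom _ _ _ _ hS). assumption.
Qed.

(** * Convolution integrals *)

Lemma continuity_2d_inner_conv {H : Hilbert} (f k : R -> H) (x y : R) :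
  continuous f y -> continuous k (x - y) ->
  continuity_2d_pt (fun u v => inner (f v) (k (u - v))) x y.
Proof.
  intros Hf Hk eps.
  destruct (inner_close (f y) (k (x - y)) eps (cond_pos eps)) as [d [Hd Hc]].
  destruct (proj1 (continuous_H_eps f y) Hf d Hd) as [d1 [Hd1 H1]].
  destruct (proj1 (continuous_H_eps k (x - y)) Hk d Hd) as [d2 [Hd2 H2]].
  assert (Hm : 0 < Rmin d1 (d2 / 2)) by (apply Rmin_pos; lra).
  exists (mkposreal _ Hm). intros u v Hu Hv. simpl in Hu, Hv.
  pose proof (Rmin_l d1 (d2 / 2)). pose proof (Rmin_r d1 (d2 / 2)).
  apply Hc; [apply H1; lra|apply H2].
  replace (u - v - (x - y)) with ((u - x) + - (v - y)) by ring.
  eapply Rle_lt_trans; [apply Rabs_triang|]. rewrite Rabs_Ropp. lra.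
Qed.

Lemma is_derive_convolution {H : Hilbert} (f k k' : R -> H) (t0 t : R) :
  (forall r, continuous f r) -> (forall r, is_derive k r (k' r)) -> (forall r, continuous k' r) ->
  is_derive (fun x => RInt (fun tau => inner (f tau) (k (x - tau))) t0 x) t
    (inner (f t) (k 0) + RInt (fun tau => inner (f tau) (k' (t - tau))) t0 t).
Proof.
  intros Hf Hk Hk'.
  assert (Hkc : forall r, continuous k r) by (intros r; apply (is_derive_continuous _ _ _ (Hk r))).
  assert (Hex : forall x a b, ex_RInt (fun tau => inner (f tau) (k (x - tau))) a b).
  { intros x a b. apply (ex_RInt_continuous (V := R_CompleteNormedModule)). intros z _.
    apply continuous_inner; [apply Hf|]. apply continuous_reflect, Hkc. }
  assert (Hd : forall u v, is_derive (fun z => inner (f v) (k (z - v))) u (inner (f v) (k' (u - v)))).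
  { intros u v.
    apply (is_derive_ext (fun z => inner (k (z - v)) (f v))); [intros; apply inner_sym|].
    rewrite (inner_sym _ (f v)). apply is_derive_inner_l, is_derive_shift, Hk. }
  assert (Hc2 : forall u v, continuity_2d_pt (fun u v => Derive (fun z => inner (f v) (k (z - v))) u) u v).
  { intros u v. apply (continuity_2d_pt_ext (fun u v => inner (f v) (k' (u - v)))).
    - intros x y. symmetry. apply is_derive_unique, Hd.
    - apply continuity_2d_inner_conv; [apply Hf|apply Hk']. }
  (* Leibniz rule with fixed lower bound and the identity as upper bound; the last argument 1 is the
     derivative of that bound. *)
  assert (Hmain := is_derive_RInt_param_bound_comp_aux3
    (fun x tau => inner (f tau) (k (x - tau))) t0 (fun x => x) t 1).
  apply (is_derive_Rval _ _ (RInt (fun tau => Derive (fun u => inner (f tau) (k (u - tau))) t) t0 t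
    + inner (f t) (k (t - t)) * 1)).
  - apply Hmain.
    + apply filter_forall. intros x. apply Hex.
    + exists (mkposreal 1 Rlt_0_1). apply filter_forall. intros x. apply Hex.
    + apply (is_derive_id t).
    + exists (mkposreal 1 Rlt_0_1). apply filter_forall. intros x tau _. eexists. apply Hd.
    + intros; apply Hc2.
    + exists (mkposreal 1 Rlt_0_1). intros; apply Hc2.
    + apply continuity_pt_filterlim.
      apply (continuous_inner f (fun tau => k (t - tau))); [apply Hf|]. apply continuous_reflect, Hkc.
  - rewrite Rminus_diag Rmult_1_r Rplus_comm. f_equal.
    apply RInt_ext. intros x _. apply is_derive_unique, Hd.
Qed.

Lemma inner_RInt {H : Hilbert} (g : R -> H) (a b : R) (z : H) :
  (forall r, continuous g r) -> inner (RInt g a b) z = RInt (fun tau => inner (g tau) z) a b.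
Proof.
  intros Hg. symmetry. apply is_RInt_unique.
  assert (Hd : forall t, is_derive (fun x => RInt g a x) t (g t)).
  { intros t. apply (is_derive_RInt g (fun x => RInt g a x) a); [|apply Hg].
    apply filter_forall. intros x. apply RInt_correct, ex_RInt_continuous. intros; apply Hg. }
  replace (inner (RInt g a b) z) with (minus (inner (RInt g a b) z) (inner (RInt g a a) z)).
  - apply (is_RInt_derive (V := R_CompleteNormedModule) (fun x => inner (RInt g a x) z)).
    + intros x _. apply is_derive_inner_l, Hd.
    + intros x _. apply continuous_inner; [apply Hg|apply continuous_const].
  - rewrite RInt_point inner_zero_l. change (inner (RInt g a b) z - 0 = inner (RInt g a b) z). ring.
Qed.

(** $S$ is used only through strong continuity, at the fixed vector [f r]; the variation of [f] is
    absorbed by [Sol_bound], which is uniform for times near [t - r]. *)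
Lemma continuous_Sol_conv {H : Hilbert} (A B : Operator H) (Sol dSol : R -> H -> H)
    (hA : self_adjoint A) (hA0 : nonneg_operator A) (hB : is_sqrt_operator A B)
    (hS : solution_operator A B Sol dSol) (f : R -> H) (t r : R) :
  continuous f r -> continuous (fun tau => Sol (t - tau) (f tau)) r.
Proof.
  intros Hf. apply continuous_H_eps. intros eps Heps.
  assert (Hs : continuous (fun tau => Sol (t - tau) (f r)) r).
  { apply (continuous_reflect (fun x => Sol x (f r))).
    apply (is_derive_continuous _ _ _ (Sol_derive _ _ _ _ hS (f r) (t - r))). }
  set (k := Rabs (t - r) + 1). assert (Hk : 0 < k) by (unfold k; pose proof (Rabs_pos (t - r)); lra).
  assert (He : 0 < eps / (2 * k)) by (apply Rdiv_lt_0_compat; lra).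
  destruct (proj1 (continuous_H_eps _ r) Hs (eps / 2) ltac:(lra)) as [d1 [Hd1 H1]].
  destruct (proj1 (continuous_H_eps f r) Hf _ He) as [d2 [Hd2 H2]].
  exists (Rmin 1 (Rmin d1 d2)). split; [repeat apply Rmin_pos; lra|]. intros x Hx.
  pose proof (Rmin_l 1 (Rmin d1 d2)). pose proof (Rmin_r 1 (Rmin d1 d2)).
  pose proof (Rmin_l d1 d2). pose proof (Rmin_r d1 d2).
  assert (Ha := H1 x ltac:(lra)). assert (Hb := H2 x ltac:(lra)). simpl in Ha.
  replace (minus (Sol (t - x) (f x)) (Sol (t - r) (f r)))
    with (plus (Sol (t - x) (minus (f x) (f r))) (minus (Sol (t - x) (f r)) (Sol (t - r) (f r))))
    by (rewrite (linear_map_minus _ (Sol_bounded _ _ _ _ hS (t - x))); vec_ring).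
  eapply Rle_lt_trans; [apply norm_plus_H|].
  pose proof (Sol_bound A B Sol dSol hA hA0 hB hS (minus (f x) (f r)) (t - x)) as C1.
  assert (C2 : Rabs (t - x) <= k).
  { unfold k. replace (t - x) with ((t - r) + - (x - r)) by ring.
    eapply Rle_trans; [apply Rabs_triang|]. rewrite Rabs_Ropp. lra. }
  assert (C3 : Rabs (t - x) * norm (minus (f x) (f r)) <= k * (eps / (2 * k))).
  { apply Rmult_le_compat; [apply Rabs_pos|apply norm_pos_H|exact C2|lra]. }
  replace (k * (eps / (2 * k))) with (eps / 2) in C3 by (field; lra).
  lra.
Qed.

(** * Weak form of the mild solution formula *)

(** Duhamel's formula with a prescribed forcing term. It makes sense for every real [t], so its
    derivatives at [t0] are two-sided. *)
Definition mild_map {H : Hilbert} (Sol dSol : R -> H -> H) (f : R -> H) (t0 : R) (u0 u1 : H)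
    (t : R) : H :=
  minus (plus (dSol (t - t0) u0) (Sol (t - t0) u1)) (RInt (fun tau => Sol (t - tau) (f tau)) t0 t).

(** Symmetry moves [Sol] and [dSol] onto the test vector, which can be chosen more regular than the
    data. *)
Lemma inner_mild_map {H : Hilbert} (A B : Operator H) (Sol dSol : R -> H -> H)
    (hA : self_adjoint A) (hA0 : nonneg_operator A) (hB : is_sqrt_operator A B)
    (hS : solution_operator A B Sol dSol) (f : R -> H) (t0 : R) (u0 u1 : H) (t : R) (z : H) :
  (forall r, continuous f r) ->
  inner (mild_map Sol dSol f t0 u0 u1 t) z
  = inner u0 (dSol (t - t0) z) + inner u1 (Sol (t - t0) z)
    - RInt (fun tau => inner (f tau) (Sol (t - tau) z)) t0 t.
Proof.
  intros Hf. unfold mild_map. inner_expand.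
  rewrite (dSol_sym A B Sol dSol hA hA0 hB hS) (Sol_sym A B Sol dSol hA hA0 hB hS).
  f_equal. f_equal. rewrite inner_RInt.
  - apply RInt_ext. intros x _. apply (Sol_sym A B Sol dSol hA hA0 hB hS).
  - intros r. apply (continuous_Sol_conv A B Sol dSol hA hA0 hB hS), Hf.
Qed.

(* For [z] in [dom A] both [z] and [A z] may be used as test vectors, so that
   [t |-> Sol t z] is three times differentiable and the formula for the mild
   solution can be differentiated twice under the integral sign. *)
Lemma mild_map_weak {H : Hilbert} (A B : Operator H) (Sol dSol : R -> H -> H)
    (hA : self_adjoint A) (hA0 : nonneg_operator A) (hB : is_sqrt_operator A B)
    (hS : solution_operator A B Sol dSol) (f : R -> H) (t0 : R) (u0 u1 z : H) :
  (forall r, continuous f r) -> dom A z ->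
  exists q : R -> R,
    (forall t, is_derive (fun t => inner (mild_map Sol dSol f t0 u0 u1 t) z) t (q t)) /\
    (forall t, is_derive q t (- inner (mild_map Sol dSol f t0 u0 u1 t) (A z) - inner (f t) z)) /\
    q t0 = inner u1 z.
Proof.
  intros Hf Hz. pose proof (proj1 (proj1 (sqrt_dom _ _ hB z) Hz)) as HzB.
  assert (Hd1 : forall r, is_derive (fun r => dSol r z) r (opp (Sol r (A z)))).
  { intros r. rewrite -(A_Sol_comm A B Sol dSol hA hA0 hB hS z r Hz). apply (Sol_equation _ _ _ _ hS), HzB. }
  assert (Hd0 : forall w r, is_derive (fun r => Sol r w) r (dSol r w)) by (intros; apply (Sol_derive _ _ _ _ hS)).
  (* The termwise derivative of the weak formula. The boundary term of the convolution vanishes here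
     because $S(0)=0$; at the next differentiation it is [inner (f t) z], because $S'(0)=I$. *)
  exists (fun t => - inner u0 (Sol (t - t0) (A z)) + inner u1 (dSol (t - t0) z)
    - RInt (fun tau => inner (f tau) (dSol (t - tau) z)) t0 t).
  assert (Hc : forall (a : H) (k : R -> H) (r : R) (l : H), is_derive k (r - t0) l ->
    is_derive (fun x => inner a (k (x - t0))) r (inner a l)).
  { intros a k r l Hk. apply (is_derive_ext (fun x => inner (k (x - t0)) a)); [intros; apply inner_sym|].
    rewrite (inner_sym _ a). apply is_derive_inner_l, is_derive_shift, Hk. }
  split; [|split].
  - intros t.
    apply (is_derive_ext (fun t => inner u0 (dSol (t - t0) z) + inner u1 (Sol (t - t0) z)
      - RInt (fun tau => inner (f tau) (Sol (t - tau) z)) t0 t)).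
    { intros r. symmetry. apply (inner_mild_map A B Sol dSol hA hA0 hB hS), Hf. }
    eapply is_derive_Rval.
    + apply is_derive_Rminus; [apply is_derive_Rplus|].
      * apply (Hc u0 (fun r => dSol r z)), Hd1.
      * apply (Hc u1 (fun r => Sol r z)), Hd0.
      * apply (is_derive_convolution f (fun r => Sol r z) (fun r => dSol r z)); [exact Hf|apply Hd0|].
        intros r. apply (is_derive_continuous _ _ _ (Hd1 r)).
    + simpl. rewrite (Sol_0 _ _ _ _ hS) inner_zero_r inner_opp_r. ring.
  - intros t. rewrite (inner_mild_map A B Sol dSol hA hA0 hB hS); [|exact Hf].
    assert (Hn : RInt (fun tau => inner (f tau) (opp (Sol (t - tau) (A z)))) t0 t
      = - RInt (fun tau => inner (f tau) (Sol (t - tau) (A z))) t0 t).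
    { transitivity (RInt (fun tau => - inner (f tau) (Sol (t - tau) (A z))) t0 t).
      - apply RInt_ext. intros x _. apply inner_opp_r.
      - apply (RInt_opp (V := R_CompleteNormedModule) (fun tau => inner (f tau) (Sol (t - tau) (A z)))).
        apply (ex_RInt_continuous (V := R_CompleteNormedModule)). intros x _.
        apply continuous_inner; [apply Hf|].
        apply (continuous_reflect (fun r => Sol r (A z))).
        apply (is_derive_continuous _ _ _ (Hd0 (A z) (t - x))). }
    eapply is_derive_Rval.
    + apply is_derive_Rminus; [apply is_derive_Rplus|].
      * apply (is_derive_ext (fun t => (-1) * inner u0 (Sol (t - t0) (A z)))); [intros; as_R_eq; ring|].
        apply is_derive_Rscal. apply (Hc u0 (fun r => Sol r (A z))), Hd0.
      * apply (Hc u1 (fun r => dSol r z)), Hd1.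
      * apply (is_derive_convolution f (fun r => dSol r z) (fun r => opp (Sol r (A z)))); [exact Hf|apply Hd1|].
        intros r. apply (continuous_opp (fun r => Sol r (A z))).
        apply (is_derive_continuous _ _ _ (Hd0 (A z) r)).
    + simpl. rewrite Hn (dSol_0 _ _ _ _ hS) inner_opp_r. ring.
  - rewrite Rminus_diag (Sol_0 _ _ _ _ hS) (dSol_0 _ _ _ _ hS) RInt_point inner_zero_r.
    change (@zero R_CompleteNormedModule) with 0. as_R_eq. ring.
Qed.

(** * The resolvent *)

Lemma parallelogram {H : Hilbert} (x y : H) :
  norm (minus x y) ^ 2 = 2 * norm x ^ 2 + 2 * norm y ^ 2 - 4 * norm (scal (/ 2) (plus x y)) ^ 2.
Proof. rewrite -!inner_norm. inner_expand. rewrite (inner_sym _ y x). field. Qed.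

Lemma H_complete {H : Hilbert} (x : nat -> H) :
  (forall eps, 0 < eps -> exists N, forall n m, (N <= n)%nat -> (N <= m)%nat ->
    norm (minus (x n) (x m)) < eps) ->
  exists l, forall eps, 0 < eps -> exists N, forall n, (N <= n)%nat -> norm (minus (x n) l) < eps.
Proof.
  intros Hx.
  destruct (proj1 (filterlim_locally_cauchy (F := eventually) x)) as [l Hl].
  - intros eps. destruct (Hx eps (cond_pos eps)) as [N HN].
    exists (fun n => (N <= n)%nat). split; [exists N; auto|].
    intros u v Hu Hv. apply (norm_compat1 (K := R_AbsRing) (V := H) (x u) (x v) eps). apply HN; assumption.
  - exists l. intros eps Heps.
    destruct (Hl (fun y => norm (minus y l) < eps)) as [N HN].
    + apply (locally_le_locally_norm (K := R_AbsRing) (V := H) l). exists (mkposreal _ Heps). intros y Hy. exact Hy.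
    + exists N. exact HN.
Qed.

Definition conv {H : Hilbert} (x : nat -> H) (l : H) : Prop :=
  forall eps, 0 < eps -> exists N, forall n, (N <= n)%nat -> norm (minus (x n) l) < eps.

Lemma conv_const {H : Hilbert} (l : H) : conv (fun _ => l) l.
Proof.
  intros eps Heps. exists 0%nat. intros n _. replace (minus l l) with (zero : H) by vec_ring.
  rewrite (norm_zero (K := R_AbsRing) (V := H)). exact Heps.
Qed.

Lemma conv_inner {H : Hilbert} (x y : nat -> H) (a b : H) :
  conv x a -> conv y b -> is_lim_seq (fun n => inner (x n) (y n)) (inner a b).
Proof.
  intros Hx Hy. apply is_lim_seq_spec. intros eps.
  destruct (inner_close a b eps (cond_pos eps)) as [d [Hd Hc]].
  destruct (Hx d Hd) as [N1 H1]. destruct (Hy d Hd) as [N2 H2].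
  exists (max N1 N2). intros n Hn. apply Hc; [apply H1|apply H2]; lia.
Qed.

(** The first-order condition at a minimum attained at [t = 0]. No sign of [c] is assumed, so the
    case [c <= 0] is settled by [t = 1] and [t = -1]. *)
Lemma quadratic_min (b c : R) : (forall t, 0 <= - 2 * t * b + t ^ 2 * c) -> b = 0.
Proof.
  intros Ht. destruct (Rle_lt_dec c 0) as [Hc|Hc].
  - pose proof (Ht 1). pose proof (Ht (-1)). nra.
  - specialize (Ht (b / c)). replace (-2 * (b / c) * b + (b / c) ^ 2 * c) with (- (b ^ 2 / c)) in Ht
      by (field; lra).
    assert (Hb : b ^ 2 <= 0).
    { assert (b ^ 2 / c * c = b ^ 2) by (field; lra). nra. }
    nra.
Qed.

Lemma norm_sq_minus_scal {H : Hilbert} (x y : H) (t : R) :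
  norm (minus x (scal t y)) ^ 2 = norm x ^ 2 - 2 * t * inner y x + t ^ 2 * norm y ^ 2.
Proof. rewrite -!inner_norm. inner_expand. rewrite (inner_sym _ x y). ring. Qed.

Definition shift {H : Hilbert} (A : Operator H) (eps : R) (w : H) : H := plus w (scal eps (A w)).

(** Nonnegativity gives $\langle w,w+\varepsilon Aw\rangle\ge\|w\|^2$. This one inequality yields
    closedness of the range and uniqueness and contractivity of the resolvent. *)
Lemma shift_expanding {H : Hilbert} (A : Operator H) (hA0 : nonneg_operator A) (eps : R) (w : H) :
  0 < eps -> dom A w -> norm w <= norm (shift A eps w).
Proof.
  intros Heps Hw. apply norm_le_of_inner; [apply norm_pos_H|].
  pose proof (hA0 w Hw) as Hp. rewrite inner_sym in Hp.
  pose proof (cauchy_schwarz w (shift A eps w)) as C. pose proof (Rle_abs (inner w (shift A eps w))).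
  assert (inner w (shift A eps w) = inner w w + eps * inner w (A w)) by (unfold shift; inner_expand; ring).
  nra.
Qed.

Lemma shift_lin {H : Hilbert} (A : Operator H) (hA : linear_operator A) (eps t : R) (x y : H) :
  dom A x -> dom A y ->
  dom A (plus x (scal t y)) /\ shift A eps (plus x (scal t y)) = plus (shift A eps x) (scal t (shift A eps y)).
Proof.
  intros Hx Hy. pose proof (dom_scal _ hA t y Hy) as Hs.
  split; [apply dom_plus; assumption|]. unfold shift. rewrite app_plus; try assumption.
  rewrite app_scal; try assumption. vec_ring.
Qed.

(* The range of [1 + eps A] is closed and its orthogonal complement is trivial,
   because [A r = - r / eps] contradicts nonnegativity unless [r = 0]. *)
Lemma shift_surjective {H : Hilbert} (A : Operator H) (hA : self_adjoint A)
    (hA0 : nonneg_operator A) (eps : R) (v : H) :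
  0 < eps -> exists w, dom A w /\ shift A eps w = v.
Proof.
  intros Heps. pose proof (sa_linear _ hA) as hl.
  (* Distances are negated so that [completeness] provides a supremum: [- L] is the squared distance
     from [v] to the range. *)
  set (P := fun x => exists w, dom A w /\ x = - norm (minus v (shift A eps w)) ^ 2).
  destruct (completeness P) as [L [HL1 HL2]].
  { exists 0. intros x [w [_ ->]]. pose proof (pow2_ge_0 (norm (minus v (shift A eps w)))). lra. }
  { eexists. exists zero. split; [apply dom_zero, hl|reflexivity]. }
  assert (Hmin : forall w, dom A w -> - L <= norm (minus v (shift A eps w)) ^ 2).
  { intros w Hw. assert (- norm (minus v (shift A eps w)) ^ 2 <= L); [|lra].
    apply HL1. exists w. split; [exact Hw|reflexivity]. }
  assert (Hseq : forall n : nat, exists w, dom A w /\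
    norm (minus v (shift A eps w)) ^ 2 < - L + / (INR n + 1)).
  { intros n. apply NNPP. intros Hn.
    assert (Hpos : 0 < / (INR n + 1)) by (apply Rinv_0_lt_compat; pose proof (pos_INR n); lra).
    assert (Hub : L <= L - / (INR n + 1)); [|lra].
    apply HL2. intros x [w [Hw ->]].
    apply Rnot_lt_le. intros Hlt. apply Hn. exists w. split; [exact Hw|]. lra. }
  pose (w := fun n => proj1_sig (constructive_indefinite_description _ (Hseq n))).
  assert (Hw : forall n, dom A (w n)) by
    (intros n; apply (proj2_sig (constructive_indefinite_description _ (Hseq n)))).
  assert (Hw2 : forall n, norm (minus v (shift A eps (w n))) ^ 2 < - L + / (INR n + 1)) by
    (intros n; apply (proj2_sig (constructive_indefinite_description _ (Hseq n)))).
  clearbody w.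
  pose (m := fun n => shift A eps (w n)).
  (* The midpoint of two points of the range lies in the range, so its squared distance to [v] is at
     least [- L], and the parallelogram identity bounds the distance of the two points. *)
  assert (Hdist : forall n k, norm (minus (m n) (m k)) ^ 2 <= 2 * / (INR n + 1) + 2 * / (INR k + 1)).
  { intros n k. pose (a := minus v (m n) : H). pose (b := minus v (m k) : H).
    pose proof (parallelogram a b) as Hp.
    replace (minus (m n) (m k)) with (minus b a) by (unfold a, b; vec_ring).
    rewrite norm_minus_sym Hp.
    destruct (shift_lin A hl eps (/ 2) (scal (/ 2) (w n)) (w k)) as [D1 D2].
    { apply dom_scal; [exact hl|apply Hw]. } { apply Hw. }
    assert (Hm : - L <= norm (scal (/ 2) (plus a b)) ^ 2).
    { replace (scal (/ 2) (plus a b)) with (minus v (shift A eps (plus (scal (/ 2) (w n)) (scal (/ 2) (w k))))).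
      - apply Hmin, D1.
      - rewrite D2. unfold a, b, m. unfold shift at 1. rewrite app_scal; [|exact hl|apply Hw].
        unfold shift. vec_ring. field. }
    pose proof (Hw2 n : norm a ^ 2 < _). pose proof (Hw2 k : norm b ^ 2 < _). lra. }
  assert (Hinv : forall e, 0 < e -> exists N, forall n, (N <= n)%nat -> / (INR n + 1) < e).
  { intros e He. destruct (archimed_cor1 e He) as [N [HN HN0]]. exists N. intros n Hn.
    apply Rlt_trans with (/ INR N); [|exact HN]. apply Rinv_lt_contravar.
    - apply Rmult_lt_0_compat; [apply lt_0_INR; exact HN0|pose proof (pos_INR n); lra].
    - apply le_INR in Hn. lra. }
  assert (Hcau : forall e, 0 < e -> exists N, forall n k, (N <= n)%nat -> (N <= k)%nat ->
    norm (minus (m n) (m k)) < e).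
  { intros e He. destruct (Hinv (e ^ 2 / 4)) as [N HN]; [apply Rdiv_lt_0_compat; [apply pow_lt|]; lra|].
    exists N. intros n k Hn Hk. pose proof (HN n Hn). pose proof (HN k Hk).
    pose proof (Hdist n k). pose proof (norm_pos_H (minus (m n) (m k))). nra. }
  assert (Hcauw : forall e, 0 < e -> exists N, forall n k, (N <= n)%nat -> (N <= k)%nat ->
    norm (minus (w n) (w k)) < e).
  { intros e He. destruct (Hcau e He) as [N HN]. exists N. intros n k Hn Hk.
    eapply Rle_lt_trans; [|apply (HN n k Hn Hk)]. unfold m.
    destruct (shift_lin A hl eps (-1) (w n) (w k) (Hw n) (Hw k)) as [D1 D2].
    replace (minus (w n) (w k)) with (plus (w n) (scal (-1) (w k))) by vec_ring.
    replace (minus (shift A eps (w n)) (shift A eps (w k)))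
      with (plus (shift A eps (w n)) (scal (-1) (shift A eps (w k)))) by vec_ring.
    rewrite -D2. apply shift_expanding; assumption. }
  destruct (H_complete m Hcau) as [ml Hml]. destruct (H_complete w Hcauw) as [wl Hwl].
  (* Closedness of [A], read off the adjoint: pass to the limit in $\langle Ay,w_n\rangle=\langle
     y,(m_n-w_n)/\varepsilon\rangle$ for fixed [y] in [dom A]. *)
  assert (Hgr : dom A wl /\ A wl = scal (/ eps) (minus ml wl)).
  { apply (sa_adjoint _ hA). intros y Hy. inner_expand.
    assert (Hlim : is_lim_seq (fun n => inner (A y) (w n)) (/ eps * (inner y ml - inner y wl))).
    { apply (is_lim_seq_ext (fun n => / eps * (inner y (m n) - inner y (w n)))).
      - intros n. rewrite (self_adjoint_sym A hA y (w n) Hy (Hw n)). unfold m, shift. inner_expand.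
        field. lra.
      - apply (is_lim_seq_scal_l _ (/ eps) (inner y ml - inner y wl)).
        apply (is_lim_seq_minus' _ _ (inner y ml) (inner y wl)); apply conv_inner; try apply conv_const; assumption. }
    pose proof (conv_inner (fun _ => A y) w (A y) wl (conv_const _) Hwl) as Hlim2.
    apply is_lim_seq_unique in Hlim. apply is_lim_seq_unique in Hlim2.
    rewrite Hlim in Hlim2. injection Hlim2 as He. now rewrite He. }
  destruct Hgr as [Hdom HA].
  assert (Hs : shift A eps wl = ml) by (unfold shift; rewrite HA; vec_ring; field; lra).
  assert (Hex : exists r : H, r = minus v ml) by (eexists; reflexivity).
  destruct Hex as [r Hrdef].
  assert (Hr : norm r ^ 2 <= - L).
  { rewrite -inner_norm.
    assert (Hc : conv (fun n => minus v (m n)) r).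
    { intros e He. destruct (Hml e He) as [N HN]. exists N. intros n Hn. rewrite Hrdef.
      replace (minus (minus v (m n)) (minus v ml)) with (minus ml (m n)) by vec_ring.
      rewrite norm_minus_sym. apply HN, Hn. }
    pose proof (conv_inner _ _ _ _ Hc Hc) as Hlim.
    assert (Hlim2 : is_lim_seq (fun n => - L + / (INR n + 1)) (- L)).
    { replace (Finite (- L)) with (Finite (- L + 0)) by (f_equal; ring).
      apply (is_lim_seq_plus' _ _ (- L) 0); [apply is_lim_seq_const|].
      apply is_lim_seq_spec. intros e. destruct (Hinv e (cond_pos e)) as [N HN].
      exists N. intros n Hn. rewrite Rminus_0_r Rabs_pos_eq; [apply HN, Hn|].
      left. apply Rinv_0_lt_compat. pose proof (pos_INR n); lra. }
    apply (is_lim_seq_le (fun n => inner (minus v (m n)) (minus v (m n))) (fun n => - L + / (INR n + 1))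
      (inner r r) (- L)); [|exact Hlim|exact Hlim2].
    intros n. rewrite inner_norm. left. apply Hw2. }
  (* The distance is minimal at [ml], hence stationary in every direction of the range. *)
  assert (Horth : forall y, dom A y -> inner (shift A eps y) r = 0).
  { intros y Hy. apply (quadratic_min _ (norm (shift A eps y) ^ 2)). intros t.
    destruct (shift_lin A hl eps t wl y Hdom Hy) as [D1 D2].
    assert (Hm : - L <= norm (minus r (scal t (shift A eps y))) ^ 2).
    { replace (minus r (scal t (shift A eps y))) with (minus v (shift A eps (plus wl (scal t y)))).
      - apply Hmin, D1.
      - rewrite D2 Hs Hrdef. vec_ring. }
    rewrite norm_sq_minus_scal in Hm. lra. }
  (* Orthogonality to the range says that [r] and its multiple by [- / eps] form a pair in the graph
     of the adjoint, which is the graph of [A]. *)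
  assert (Hr0 : dom A r /\ A r = scal (- / eps) r).
  { apply (sa_adjoint _ hA). intros y Hy. specialize (Horth y Hy). unfold shift in Horth.
    revert Horth. inner_expand. intros Horth.
    apply (Rmult_eq_reg_l eps); [|lra]. rewrite -Rmult_assoc. field_simplify; lra. }
  destruct Hr0 as [Hrd HrA]. pose proof (hA0 r Hrd) as Hp. rewrite HrA inner_scal in Hp.
  pose proof (inner_ge_0 r) as Hrr. pose proof (Rinv_0_lt_compat eps Heps).
  assert (Hr0 : r = zero) by (apply inner_self_0; nra).
  exists wl. split; [exact Hdom|]. rewrite Hs. replace v with (plus ml r) by (rewrite Hrdef; vec_ring).
  rewrite Hr0. vec_ring.
Qed.

Lemma norm_minus_triangle {H : Hilbert} (x y z : H) :
  norm (minus x z) <= norm (minus x y) + norm (minus y z).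
Proof.
  replace (minus x z) with (plus (minus x y) (minus y z)) by vec_ring. apply norm_plus_H.
Qed.

Lemma inv_INR_succ_pos (n : nat) : 0 < / (INR n + 1).
Proof. apply Rinv_0_lt_compat. pose proof (pos_INR n). lra. Qed.

(** Only a right inverse of $1+\varepsilon A$ is recorded; [shift_expanding] makes it two-sided. *)
Definition is_resolvent {H : Hilbert} (A : Operator H) (eps : R) (J : H -> H) : Prop :=
  forall v, dom A (J v) /\ shift A eps (J v) = v.

Lemma resolvent_unique {H : Hilbert} (A : Operator H) (hA : self_adjoint A)
    (hA0 : nonneg_operator A) (eps : R) (heps : 0 < eps) (J : H -> H) (hJ : is_resolvent A eps J)
    (w v : H) :
  dom A w -> shift A eps w = v -> J v = w.
Proof.
  intros Hw Hs. destruct (hJ v) as [D1 D2].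
  destruct (shift_lin A (sa_linear _ hA) eps (-1) (J v) w D1 Hw) as [D3 D4].
  pose proof (shift_expanding A hA0 eps _ heps D3) as Hn.
  rewrite D4 D2 Hs in Hn.
  replace (plus v (scal (-1) v)) with (zero : H) in Hn by vec_ring.
  rewrite (norm_zero (K := R_AbsRing) (V := H)) in Hn.
  assert (Hz : plus (J v) (scal (-1) w) = zero).
  { apply inner_self_0. rewrite inner_norm. pose proof (norm_pos_H (plus (J v) (scal (-1) w))). nra. }
  replace (J v) with (plus (plus (J v) (scal (-1) w)) w) by vec_ring. rewrite Hz. vec_ring.
Qed.

Lemma resolvent_contraction {H : Hilbert} (A : Operator H) (hA0 : nonneg_operator A) (eps : R)
    (heps : 0 < eps) (J : H -> H) (hJ : is_resolvent A eps J) (v : H) : norm (J v) <= norm v.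
Proof.
  destruct (hJ v) as [D1 D2]. rewrite -{2}D2. apply shift_expanding; assumption.
Qed.

Lemma resolvent_minus {H : Hilbert} (A : Operator H) (hA : self_adjoint A)
    (hA0 : nonneg_operator A) (eps : R) (heps : 0 < eps) (J : H -> H) (hJ : is_resolvent A eps J)
    (v w : H) : J (minus v w) = minus (J v) (J w).
Proof.
  destruct (hJ v) as [D1 D2]. destruct (hJ w) as [D3 D4].
  destruct (shift_lin A (sa_linear _ hA) eps (-1) (J v) (J w) D1 D3) as [D5 D6].
  replace (minus (J v) (J w)) with (plus (J v) (scal (-1) (J w))) by vec_ring.
  apply (resolvent_unique A hA hA0 eps heps J hJ); [exact D5|]. rewrite D6 D2 D4. vec_ring.
Qed.

Lemma resolvent_scal {H : Hilbert} (A : Operator H) (hA : self_adjoint A)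
    (hA0 : nonneg_operator A) (eps : R) (heps : 0 < eps) (J : H -> H) (hJ : is_resolvent A eps J)
    (a : R) (v : H) : J (scal a v) = scal a (J v).
Proof.
  destruct (hJ v) as [D1 D2].
  apply (resolvent_unique A hA hA0 eps heps J hJ).
  - apply dom_scal; [apply hA|exact D1].
  - unfold shift. rewrite app_scal; [|apply hA|exact D1]. rewrite -{3}D2. unfold shift. vec_ring.
Qed.

Lemma resolvent_sym {H : Hilbert} (A : Operator H) (hA : self_adjoint A) (eps : R)
    (J : H -> H) (hJ : is_resolvent A eps J) (v w : H) : inner (J v) w = inner v (J w).
Proof.
  destruct (hJ v) as [D1 D2]. destruct (hJ w) as [D3 D4].
  rewrite -{1}D4 -{2}D2. unfold shift.
  rewrite inner_plus_r inner_scal_r inner_plus inner_scal (self_adjoint_sym A hA); [reflexivity|assumption..].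
Qed.

(** The Yosida approximation: [A] composed with [J] is a bounded operator, so it preserves
    continuity and differentiability in time. *)
Lemma A_resolvent {H : Hilbert} (A : Operator H) (eps : R) (heps : 0 < eps)
    (J : H -> H) (hJ : is_resolvent A eps J) (v : H) : A (J v) = scal (/ eps) (minus v (J v)).
Proof.
  destruct (hJ v) as [D1 D2]. rewrite -{2}D2. unfold shift. vec_ring. field. lra.
Qed.

(** The point is that [B (J v)] lies in [dom A]: by the resolvent equation [A (J v)] is a multiple
    of [minus v (J v)], hence in [dom B]. Applying $1+\varepsilon A$ to [B (J v)] then returns
    [B v]. *)
Lemma B_resolvent {H : Hilbert} (A B : Operator H) (hA : self_adjoint A)
    (hA0 : nonneg_operator A) (hB : is_sqrt_operator A B) (eps : R) (heps : 0 < eps)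
    (J : H -> H) (hJ : is_resolvent A eps J) (v : H) : dom B v -> J (B v) = B (J v).
Proof.
  intros Hv. destruct (hJ v) as [D1 D2].
  pose proof (sa_linear _ (sqrt_self_adjoint _ _ hB)) as hl.
  destruct (proj1 (sqrt_dom _ _ hB _) D1) as [E1 E2].
  pose proof (sqrt_app _ _ hB _ D1) as E3.
  assert (E4 : dom B (A (J v))).
  { rewrite (A_resolvent A eps heps J hJ). apply dom_scal; [exact hl|].
    apply (dom_minus B hl v (J v) Hv E1). }
  assert (E5 : dom A (B (J v))).
  { apply (sqrt_dom _ _ hB). split; [exact E2|]. rewrite -E3. exact E4. }
  apply (resolvent_unique A hA hA0 eps heps J hJ); [exact E5|].
  unfold shift. rewrite (sqrt_app _ _ hB _ E5) -E3.
  rewrite -{3}D2. unfold shift. rewrite app_plus; [|exact hl|exact E1|apply dom_scal; assumption].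
  rewrite app_scal; [reflexivity|exact hl|exact E4].
Qed.

(** Expresses the regularized potential energy through the bounded operator $AJ$, that is, in a form
    that can be differentiated in time. *)
Lemma inner_A_resolvent {H : Hilbert} (A B : Operator H) (hA : self_adjoint A)
    (hA0 : nonneg_operator A) (hB : is_sqrt_operator A B) (eps : R) (heps : 0 < eps)
    (J : H -> H) (hJ : is_resolvent A eps J) (v : H) :
  dom B v -> inner (A (J v)) (J v) = inner (J (B v)) (J (B v)).
Proof.
  intros Hv. destruct (hJ v) as [D1 _]. destruct (proj1 (sqrt_dom _ _ hB _) D1) as [E1 E2].
  rewrite (B_resolvent A B hA hA0 hB eps heps J hJ v Hv) (sqrt_app _ _ hB _ D1).
  apply (self_adjoint_sym B (sqrt_self_adjoint _ _ hB)); assumption.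
Qed.

Lemma resolvent_family {H : Hilbert} (A : Operator H) (hA : self_adjoint A)
    (hA0 : nonneg_operator A) :
  exists J : nat -> H -> H, forall n, is_resolvent A (/ (INR n + 1)) (J n).
Proof.
  pose proof inv_INR_succ_pos as Hp.
  exists (fun n v => proj1_sig (constructive_indefinite_description _ (shift_surjective A hA hA0 _ v (Hp n)))).
  intros n v. apply (proj2_sig (constructive_indefinite_description _ (shift_surjective A hA hA0 _ v (Hp n)))).
Qed.

Lemma resolvent_conv {H : Hilbert} (A : Operator H) (hA : self_adjoint A)
    (hA0 : nonneg_operator A) (J : nat -> H -> H)
    (hJ : forall n, is_resolvent A (/ (INR n + 1)) (J n)) (v : H) :
  conv (fun n => J n v) v.
Proof.
  pose proof inv_INR_succ_pos as Hp.
  intros e He. destruct (sa_dense _ hA v (e / 4)) as [w [Hw Hvw]]; [lra|].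
  pose proof (norm_pos_H (A w)) as HA.
  destruct (archimed_cor1 (e / (4 * (norm (A w) + 1)))) as [N [HN HN0]].
  { apply Rdiv_lt_0_compat; lra. }
  exists N. intros n Hn.
  assert (C1 : norm (minus (J n w) w) <= / (INR n + 1) * norm (A w)).
  { replace (minus (J n w) w) with (J n (minus w (shift A (/ (INR n + 1)) w))).
    - eapply Rle_trans; [apply (resolvent_contraction A hA0 _ (Hp n) _ (hJ n))|].
      replace (minus w (shift A (/ (INR n + 1)) w)) with (scal (- / (INR n + 1)) (A w))
        by (unfold shift; vec_ring).
      eapply Rle_trans; [apply norm_scal_H|]. rewrite Rabs_Ropp Rabs_pos_eq; [|left; apply Hp].
      apply Rle_refl.
    - rewrite (resolvent_minus A hA hA0 _ (Hp n) _ (hJ n)). f_equal. f_equal.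
      apply (resolvent_unique A hA hA0 _ (Hp n) _ (hJ n)); [exact Hw|reflexivity]. }
  assert (C2 : / (INR n + 1) <= / INR N).
  { apply Rinv_le_contravar; [apply lt_0_INR; exact HN0|]. apply le_INR in Hn. lra. }
  assert (C3 : norm (minus (J n v) (J n w)) < e / 4).
  { rewrite -(resolvent_minus A hA hA0 _ (Hp n) _ (hJ n)).
    eapply Rle_lt_trans; [apply (resolvent_contraction A hA0 _ (Hp n) _ (hJ n))|exact Hvw]. }
  assert (C4 : / INR N * norm (A w) < e / 4).
  { apply Rle_lt_trans with (e / (4 * (norm (A w) + 1)) * norm (A w)).
    - apply Rmult_le_compat_r; lra.
    - apply (Rmult_lt_reg_r (4 * (norm (A w) + 1))); [lra|]. field_simplify; [|lra]. nra. }
  assert (C5 : / (INR n + 1) * norm (A w) <= / INR N * norm (A w)) by (apply Rmult_le_compat_r; assumption).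
  pose proof (norm_minus_triangle (J n v) (J n w) v). pose proof (norm_minus_triangle (J n w) w v).
  pose proof (norm_minus_sym w v). lra.
Qed.

(** * Strong derivatives and regularization *)

Lemma segment_right_of (t0 t r c : R) :
  Rabs (r - t) < t - t0 -> Rmin t r <= c <= Rmax t r -> t0 < c /\ Rabs (c - t) <= Rabs (r - t).
Proof.
  unfold Rmin, Rmax. destruct (Rle_dec t r) as [Hle|Hle]; intros Hr Hc.
  - rewrite (Rabs_pos_eq (r - t)) in Hr |- *; [|lra..]. rewrite Rabs_pos_eq; lra.
  - rewrite (Rabs_left1 (r - t)) in Hr |- *; [|lra..]. rewrite Rabs_left1; lra.
Qed.

(** The Taylor remainder [x] is tested against itself: the scalar mean value theorem gives
    $\|x\|^2=(r-t)\langle g(c)-g(t),x\rangle$. The point [c] depends on [x], which is harmless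
    because [g] is continuous in norm. *)
Lemma is_derive_of_weak {H : Hilbert} (W g : R -> H) (t0 t : R) :
  t0 < t -> continuous g t ->
  (forall z r, t0 < r -> is_derive (fun x => inner (W x) z) r (inner (g r) z)) ->
  is_derive W t (g t).
Proof.
  intros Ht Hg Hw. apply is_derive_H_eps. intros eps Heps.
  destruct (proj1 (continuous_H_eps g t) Hg eps Heps) as [d [Hd Hd']].
  exists (Rmin d (t - t0)). split; [apply Rmin_pos; lra|]. intros r Hr.
  pose proof (Rmin_l d (t - t0)). pose proof (Rmin_r d (t - t0)).
  apply norm_le_of_inner; [apply Rmult_le_pos; [lra|apply Rabs_pos]|].
  assert (Hex : exists x : H, x = minus (minus (W r) (W t)) (scal (r - t) (g t))) by (eexists; reflexivity).
  destruct Hex as [x Hx]. rewrite -Hx.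
  assert (Hrange : forall c, Rmin t r <= c <= Rmax t r -> t0 < c /\ Rabs (c - t) <= Rabs (r - t)).
  { intros c Hc. apply segment_right_of; [lra|exact Hc]. }
  destruct (MVT_gen (fun y => inner (W y) x) t r (fun y => inner (g y) x)) as [c [Hc Hm]].
  - intros y Hy. apply Hw. apply Hrange. lra.
  - intros y Hy. apply continuity_pt_filterlim.
    apply (is_derive_continuous (V := R_NormedModule) (fun y => inner (W y) x) y (inner (g y) x)).
    apply Hw. apply Hrange, Hy.
  - destruct (Hrange c Hc) as [Hc1 Hc2].
    assert (Hxx : inner x x = (r - t) * inner (minus (g c) (g t)) x).
    { rewrite {1}Hx. rewrite !inner_minus_l inner_scal. lra. }
    rewrite Hxx. eapply Rle_trans; [apply Rle_abs|]. rewrite Rabs_mult.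
    pose proof (cauchy_schwarz (minus (g c) (g t)) x) as C.
    specialize (Hd' c ltac:(lra)). pose proof (norm_pos_H x). pose proof (Rabs_pos (r - t)).
    assert (norm (minus (g c) (g t)) * norm x <= eps * norm x) by (apply Rmult_le_compat_r; lra).
    replace (eps * Rabs (r - t) * norm x) with (Rabs (r - t) * (eps * norm x)) by ring.
    apply Rmult_le_compat_l; lra.
Qed.

Lemma resolvent_derive {H : Hilbert} (A : Operator H) (hA : self_adjoint A)
    (hA0 : nonneg_operator A) (eps : R) (heps : 0 < eps) (J : H -> H) (hJ : is_resolvent A eps J)
    (x : R -> H) (t : R) (x' : H) :
  is_derive x t x' -> is_derive (fun r => J (x r)) t (J x').
Proof.
  intros Hx. apply is_derive_H_eps. intros e He.
  destruct (proj1 (is_derive_H_eps x t x') Hx e He) as [d [Hd Hd']].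
  exists d. split; [exact Hd|]. intros r Hr.
  rewrite -(resolvent_scal A hA hA0 eps heps J hJ) -!(resolvent_minus A hA hA0 eps heps J hJ).
  eapply Rle_trans; [apply (resolvent_contraction A hA0 eps heps J hJ)|]. apply Hd', Hr.
Qed.

Lemma resolvent_continuous {H : Hilbert} (A : Operator H) (hA : self_adjoint A)
    (hA0 : nonneg_operator A) (eps : R) (heps : 0 < eps) (J : H -> H) (hJ : is_resolvent A eps J)
    (x : R -> H) (t : R) :
  continuous x t -> continuous (fun r => J (x r)) t.
Proof.
  intros Hx. apply continuous_H_eps. intros e He.
  destruct (proj1 (continuous_H_eps x t) Hx e He) as [d [Hd Hd']].
  exists d. split; [exact Hd|]. intros r Hr.
  rewrite -(resolvent_minus A hA hA0 eps heps J hJ).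
  eapply Rle_lt_trans; [apply (resolvent_contraction A hA0 eps heps J hJ)|]. apply Hd', Hr.
Qed.

(** * Energy identity for weak solutions *)

(** The intermediate point of the mean value theorem varies with [n]; equicontinuity lets [dn n c]
    be replaced by [dn n t] with an error uniform in [n]. Pointwise limits then suffice. *)
Lemma is_derive_limit (t0 : R) (g d : R -> R) (gn dn : nat -> R -> R) :
  (forall n t, t0 < t -> is_derive (gn n) t (dn n t)) ->
  (forall t, is_lim_seq (fun n => gn n t) (g t)) ->
  (forall t, is_lim_seq (fun n => dn n t) (d t)) ->
  (forall t eps, 0 < eps -> exists delta, 0 < delta /\
     forall n r, Rabs (r - t) < delta -> Rabs (dn n r - dn n t) <= eps) ->
  forall t, t0 < t -> is_derive g t (d t).
Proof.
  intros Hgn Hg Hd Heq t Ht. apply is_derive_R_eps. intros eps Heps.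
  destruct (Heq t eps Heps) as [e [He Hee]].
  exists (Rmin e (t - t0)). split; [apply Rmin_pos; lra|]. intros r Hr.
  pose proof (Rmin_l e (t - t0)). pose proof (Rmin_r e (t - t0)).
  assert (Hrange : forall c, Rmin t r <= c <= Rmax t r -> t0 < c /\ Rabs (c - t) <= Rabs (r - t)).
  { intros c Hc. apply segment_right_of; [lra|exact Hc]. }
  apply (is_lim_seq_le (fun n => Rabs (gn n r - gn n t - (r - t) * dn n t)) (fun _ => eps * Rabs (r - t))
    (Rabs (g r - g t - (r - t) * d t)) (eps * Rabs (r - t))).
  - intros n.
    destruct (MVT_gen (gn n) t r (dn n)) as [c [Hc Hm]].
    + intros y Hy. apply Hgn, Hrange. lra.
    + intros y Hy. apply continuity_pt_filterlim.
      apply (is_derive_continuous (V := R_NormedModule) (gn n) y (dn n y)), Hgn, Hrange, Hy.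
    + destruct (Hrange c Hc) as [Hc1 Hc2].
      replace (gn n r - gn n t - (r - t) * dn n t) with ((dn n c - dn n t) * (r - t)) by lra.
      rewrite Rabs_mult. apply Rmult_le_compat_r; [apply Rabs_pos|]. apply Hee. lra.
  - apply (is_lim_seq_abs _ (g r - g t - (r - t) * d t)).
    apply (is_lim_seq_minus' _ _ (g r - g t) ((r - t) * d t)).
    + apply (is_lim_seq_minus' _ _ (g r) (g t)); apply Hg.
    + apply (is_lim_seq_scal_l _ (r - t) (d t)), Hd.
  - apply is_lim_seq_const.
Qed.

Definition equicontinuous (dn : nat -> R -> R) : Prop :=
  forall t eps, 0 < eps -> exists delta, 0 < delta /\
    forall n r, Rabs (r - t) < delta -> Rabs (dn n r - dn n t) <= eps.

Lemma equicontinuous_resolvent {H : Hilbert} (A : Operator H) (hA : self_adjoint A)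
    (hA0 : nonneg_operator A) (J : nat -> H -> H)
    (hJ : forall n, is_resolvent A (/ (INR n + 1)) (J n)) (a b : R -> H) :
  (forall t, continuous a t) -> (forall t, continuous b t) ->
  equicontinuous (fun n t => inner (J n (a t)) (J n (b t))).
Proof.
  pose proof inv_INR_succ_pos as Hp.
  intros Ha Hb t eps Heps.
  destruct (product_close (a t) (b t) eps Heps) as [d [Hd Hc]].
  destruct (proj1 (continuous_H_eps a t) (Ha t) d Hd) as [d1 [Hd1 H1]].
  destruct (proj1 (continuous_H_eps b t) (Hb t) d Hd) as [d2 [Hd2 H2]].
  exists (Rmin d1 d2). split; [apply Rmin_pos; assumption|]. intros n r Hr.
  pose proof (Rmin_l d1 d2). pose proof (Rmin_r d1 d2).
  specialize (Hc (a r) (b r) (H1 r ltac:(lra)) (H2 r ltac:(lra))).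
  replace (inner (J n (a r)) (J n (b r)) - inner (J n (a t)) (J n (b t)))
    with (inner (J n (minus (a r) (a t))) (J n (b r)) + inner (J n (a t)) (J n (minus (b r) (b t))))
    by (rewrite !(resolvent_minus A hA hA0 _ (Hp n) _ (hJ n)); inner_expand; ring).
  eapply Rle_trans; [apply Rabs_triang|].
  pose proof (cauchy_schwarz (J n (minus (a r) (a t))) (J n (b r))) as C1.
  pose proof (cauchy_schwarz (J n (a t)) (J n (minus (b r) (b t)))) as C2.
  pose proof (fun v => resolvent_contraction A hA0 _ (Hp n) _ (hJ n) v) as K.
  assert (D1 : norm (J n (minus (a r) (a t))) * norm (J n (b r)) <= norm (minus (a r) (a t)) * norm (b r))
    by (apply Rmult_le_compat; [apply norm_pos_H|apply norm_pos_H|apply K|apply K]).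
  assert (D2 : norm (J n (a t)) * norm (J n (minus (b r) (b t))) <= norm (a t) * norm (minus (b r) (b t)))
    by (apply Rmult_le_compat; [apply norm_pos_H|apply norm_pos_H|apply K|apply K]).
  lra.
Qed.

Lemma equicontinuous_minus (f g : nat -> R -> R) :
  equicontinuous f -> equicontinuous g -> equicontinuous (fun n t => f n t - g n t).
Proof.
  intros Hf Hg t eps Heps.
  destruct (Hf t (eps / 2) ltac:(lra)) as [d1 [Hd1 H1]].
  destruct (Hg t (eps / 2) ltac:(lra)) as [d2 [Hd2 H2]].
  exists (Rmin d1 d2). split; [apply Rmin_pos; assumption|]. intros n r Hr.
  pose proof (Rmin_l d1 d2). pose proof (Rmin_r d1 d2).
  specialize (H1 n r ltac:(lra)). specialize (H2 n r ltac:(lra)).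
  replace (f n r - g n r - (f n t - g n t)) with ((f n r - f n t) + - (g n r - g n t)) by ring.
  eapply Rle_trans; [apply Rabs_triang|]. rewrite Rabs_Ropp. lra.
Qed.

(** The equation $u''+Au+f=0$ as a first-order equation for [V], tested against [dom A]. The
    functions are continuous on the whole line, so that continuity at [t0] is two-sided, while the
    equations hold only after [t0]. *)
Record weak_solution {H : Hilbert} (A B : Operator H) (t0 : R) (U V f : R -> H) : Prop := {
  weak_dom : forall t, dom B (U t);
  weak_U_continuous : forall t, continuous U t;
  weak_V_continuous : forall t, continuous V t;
  weak_BU_continuous : forall t, continuous (fun r => B (U r)) t;
  weak_f_continuous : forall t, continuous f t;
  weak_U_derive : forall t, t0 < t -> is_derive U t (V t);
  weak_V_derive : forall z t, dom A z -> t0 < t ->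
    is_derive (fun r => inner (V r) z) t (- inner (U t) (A z) - inner (f t) z)
}.

(** For every [z] the vector [J z] is an admissible test vector. Hence [J (V r)] has a weak
    derivative against all of [H], and this derivative is continuous in norm by the Yosida
    formula. *)
Lemma weak_resolvent {H : Hilbert} (A B : Operator H) (hA : self_adjoint A)
    (hA0 : nonneg_operator A) (t0 : R) (U V f : R -> H) (hw : weak_solution A B t0 U V f)
    (eps : R) (heps : 0 < eps) (J : H -> H) (hJ : is_resolvent A eps J) (t : R) :
  t0 < t -> is_derive (fun r => J (V r)) t (opp (plus (A (J (U t))) (J (f t)))).
Proof.
  intros Ht.
  apply (is_derive_of_weak (fun r => J (V r)) (fun r => opp (plus (A (J (U r))) (J (f r)))) t0 t Ht).
  - apply (continuous_opp (fun r => plus (A (J (U r))) (J (f r)))).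
    apply (continuous_plus (fun r => A (J (U r))) (fun r => J (f r))).
    + apply (continuous_ext (fun r => scal (/ eps) (minus (U r) (J (U r))))).
      { intros r. symmetry. apply (A_resolvent A eps heps J hJ). }
      apply (continuous_scal_r (/ eps) (fun r => minus (U r) (J (U r)))).
      apply (continuous_minus U (fun r => J (U r))); [apply hw|].
      apply (resolvent_continuous A hA hA0 eps heps J hJ). apply hw.
    + apply (resolvent_continuous A hA hA0 eps heps J hJ). apply hw.
  - intros z r Hr. destruct (hJ z) as [D1 _].
    apply (is_derive_ext (fun x => inner (V x) (J z))).
    { intros x. symmetry. apply (resolvent_sym A hA eps J hJ). }
    apply (is_derive_Rval _ _ _ _ (weak_V_derive _ _ _ _ _ _ hw (J z) r D1 Hr)).
    rewrite !(A_resolvent A eps heps J hJ). inner_expand.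
    rewrite !(resolvent_sym A hA eps J hJ). ring.
Qed.

Lemma energy_derive {H : Hilbert} (A B : Operator H) (hA : self_adjoint A)
    (hA0 : nonneg_operator A) (hB : is_sqrt_operator A B)
    (t0 : R) (U V f : R -> H) (hw : weak_solution A B t0 U V f) (t : R) :
  t0 < t ->
  is_derive (fun r => inner (V r) (V r) + inner (B (U r)) (B (U r))) t (-2 * inner (V t) (f t)).
Proof.
  intros Ht. destruct (resolvent_family A hA hA0) as [J hJ].
  pose proof inv_INR_succ_pos as Hp.
  pose proof (resolvent_conv A hA hA0 J hJ) as hc.
  revert t Ht.
  apply (is_derive_limit t0 _ (fun t => -2 * inner (V t) (f t))
    (fun n r => inner (J n (V r)) (J n (V r)) + inner (J n (B (U r))) (J n (B (U r))))
    (fun n r => -2 * inner (J n (V r)) (J n (f r)))).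
  - intros n t Ht.
    pose proof (weak_resolvent A B hA hA0 t0 U V f hw _ (Hp n) _ (hJ n) t Ht) as H1.
    pose proof (weak_U_derive _ _ _ _ _ _ hw t Ht) as H2.
    pose proof (resolvent_derive A hA hA0 _ (Hp n) _ (hJ n) _ _ _ H2) as H3.
    (* The potential term is rewritten with $AJ_n=(n+1)(1-J_n)$, leaving only the differentiable
       functions [U] and [J n (U r)]. *)
    apply (is_derive_ext (fun r => inner (J n (V r)) (J n (V r))
      + (INR n + 1) * inner (minus (U r) (J n (U r))) (J n (U r)))).
    { intros r.
      rewrite -(inner_A_resolvent A B hA hA0 hB _ (Hp n) _ (hJ n)); [|apply hw].
      rewrite (A_resolvent A _ (Hp n) _ (hJ n)) inner_scal Rinv_inv. reflexivity. }
    pose proof (is_derive_minus _ _ _ _ _ H2 H3) as H4.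
    apply (is_derive_Rval _ _ _ _ (is_derive_Rplus _ _ _ _ _ (is_derive_inner _ _ t _ _ H1 H1)
      (is_derive_Rscal _ _ _ (INR n + 1) (is_derive_inner _ _ t _ _ H4 H3)))).
    rewrite (A_resolvent A _ (Hp n) _ (hJ n)) Rinv_inv.
    simpl. inner_expand.
    (* Symmetry of [J n] makes the kinetic and potential contributions $\pm2\langle
       AJ_nU,J_nV\rangle$ cancel before the limit, where they would have no meaning. *)
    assert (E1 : inner (V t) (J n (U t)) = inner (U t) (J n (V t)))
      by (rewrite -(resolvent_sym A hA _ _ (hJ n)); apply inner_sym).
    rewrite E1 (inner_sym _ (J n (V t)) (U t)) (inner_sym _ (J n (V t)) (J n (U t)))
      (inner_sym _ (J n (f t)) (J n (V t))). ring.
  - intros r. apply (is_lim_seq_plus' _ _ (inner (V r) (V r)) (inner (B (U r)) (B (U r))));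
      apply conv_inner; apply hc.
  - intros r. apply (is_lim_seq_scal_l _ (-2) (inner (V r) (f r))). apply conv_inner; apply hc.
  - assert (He : equicontinuous (fun n r => inner (J n (V r)) (J n (f r))))
      by (apply (equicontinuous_resolvent A hA hA0 J hJ); apply hw).
    intros r e Hee. destruct (He r (e / 2) ltac:(lra)) as [d [Hd Hd']].
    exists d. split; [exact Hd|]. intros n x Hx. specialize (Hd' n x Hx).
    rewrite -Rmult_minus_distr_l Rabs_mult (Rabs_left (-2)); lra.
Qed.

Lemma cross_derive {H : Hilbert} (A B : Operator H) (hA : self_adjoint A)
    (hA0 : nonneg_operator A) (hB : is_sqrt_operator A B)
    (t0 : R) (U V f : R -> H) (hw : weak_solution A B t0 U V f) (t : R) :
  t0 < t ->
  is_derive (fun r => inner (V r) (U r)) t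
    (inner (V t) (V t) - inner (B (U t)) (B (U t)) - inner (f t) (U t)).
Proof.
  intros Ht. destruct (resolvent_family A hA hA0) as [J hJ].
  pose proof inv_INR_succ_pos as Hp.
  pose proof (resolvent_conv A hA hA0 J hJ) as hc.
  revert t Ht.
  apply (is_derive_limit t0 _ (fun t => inner (V t) (V t) - inner (B (U t)) (B (U t)) - inner (f t) (U t))
    (fun n r => inner (J n (V r)) (J n (U r)))
    (fun n r => inner (J n (V r)) (J n (V r)) - inner (J n (B (U r))) (J n (B (U r)))
      - inner (J n (f r)) (J n (U r)))).
  - intros n t Ht.
    pose proof (weak_resolvent A B hA hA0 t0 U V f hw _ (Hp n) _ (hJ n) t Ht) as H1.
    pose proof (resolvent_derive A hA hA0 _ (Hp n) _ (hJ n) _ _ _ (weak_U_derive _ _ _ _ _ _ hw t Ht)) as H3.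
    apply (is_derive_Rval _ _ _ _ (is_derive_inner _ _ t _ _ H1 H3)).
    rewrite -(inner_A_resolvent A B hA hA0 hB _ (Hp n) _ (hJ n)); [|apply hw].
    simpl. inner_expand. ring.
  - intros r. apply conv_inner; apply hc.
  - intros r.
    apply (is_lim_seq_minus' _ _ (inner (V r) (V r) - inner (B (U r)) (B (U r))) (inner (f r) (U r)));
      [apply (is_lim_seq_minus' _ _ (inner (V r) (V r)) (inner (B (U r)) (B (U r))))|];
      apply conv_inner; apply hc.
  - apply equicontinuous_minus; [apply equicontinuous_minus|];
      apply (equicontinuous_resolvent A hA hA0 J hJ); apply hw.
Qed.

(** * The nonlinearity *)

Lemma norm1_sq {H : Hilbert} (B : Operator H) (v : H) :
  norm1 B v ^ 2 = norm v ^ 2 + norm (B v) ^ 2.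
Proof.
  unfold norm1. rewrite pow2_sqrt; [reflexivity|].
  pose proof (pow2_ge_0 (norm v)). pose proof (pow2_ge_0 (norm (B v))). lra.
Qed.

Lemma norm1_pos {H : Hilbert} (B : Operator H) (v : H) : 0 <= norm1 B v.
Proof. apply sqrt_pos. Qed.

Lemma norm1_le {H : Hilbert} (B : Operator H) (v : H) : norm1 B v <= norm v + norm (B v).
Proof.
  pose proof (norm1_sq B v). pose proof (norm1_pos B v).
  pose proof (norm_pos_H v). pose proof (norm_pos_H (B v)). nra.
Qed.

Lemma norm_le_norm1 {H : Hilbert} (B : Operator H) (v : H) : norm v <= norm1 B v.
Proof.
  pose proof (norm1_sq B v). pose proof (norm1_pos B v).
  pose proof (norm_pos_H v). pose proof (norm_pos_H (B v)). nra.
Qed.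

Lemma norm_B_le_norm1 {H : Hilbert} (B : Operator H) (v : H) : norm (B v) <= norm1 B v.
Proof.
  pose proof (norm1_sq B v). pose proof (norm1_pos B v).
  pose proof (norm_pos_H v). pose proof (norm_pos_H (B v)). nra.
Qed.

Lemma gradF_continuous {H : Hilbert} (B : Operator H) (hl : linear_operator B) (s : R) (F : H -> R)
    (gradF : H -> H) (hF : nonlinearity B s F gradF) (w : H) (eps : R) :
  dom B w -> 0 < eps ->
  exists d, 0 < d /\ forall v, dom B v -> norm (minus v w) <= d -> norm (B (minus v w)) <= d ->
    norm (minus (gradF v) (gradF w)) <= eps.
Proof.
  intros Hw Heps. destruct (gradF_lipschitz _ _ _ _ hF) as [L0 [_ [Hbd HL]]].
  pose proof (norm_pos_H w). pose proof (norm_pos_H (B w)).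
  (* The 2 allows for changes of at most 1 in [norm v] and in [norm (B v)], so one constant [K]
     serves all nearby [v]. *)
  destruct (Hbd (norm w + norm (B w) + 2)) as [K HK].
  set (d := Rmin 1 (eps / (2 * (Rabs K + 1)))).
  pose proof (Rabs_pos K). pose proof (Rle_abs K).
  assert (Hd0 : 0 < d) by (apply Rmin_pos; [lra|apply Rdiv_lt_0_compat; lra]).
  assert (Hd1 : d <= 1) by apply Rmin_l.
  assert (Hd2 : (Rabs K + 1) * (2 * d) <= eps).
  { replace eps with ((Rabs K + 1) * (2 * (eps / (2 * (Rabs K + 1))))) at 1 by (field; lra).
    apply Rmult_le_compat_l; [lra|]. apply Rmult_le_compat_l; [lra|]. apply Rmin_r. }
  exists d. split; [exact Hd0|]. intros v Hv K1 K2.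
  pose proof (norm1_le B (minus v w)) as N1. pose proof (norm1_le B v) as N2. pose proof (norm1_le B w) as N3.
  pose proof (norm_minus_le v w) as N4. pose proof (norm_minus_le (B v) (B w)) as N5.
  rewrite -(proj2 (dom_minus B hl v w Hv Hw)) in N5.
  pose proof (norm1_pos B v). pose proof (norm1_pos B w). pose proof (norm1_pos B (minus v w)).
  assert (HKv : L0 (norm1 B v) (norm1 B w) <= K).
  { apply HK; split; try assumption; [|lra].
    apply Rle_trans with (1 := N2). clear -N4 N5 K1 K2 Hd1. lra. }
  eapply Rle_trans; [apply (HL v w Hv Hw)|].
  apply Rle_trans with ((Rabs K + 1) * norm1 B (minus v w)).
  - apply Rmult_le_compat_r; [assumption|lra].
  - apply Rle_trans with ((Rabs K + 1) * (2 * d)); [|exact Hd2].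
    apply Rmult_le_compat_l; lra.
Qed.

Lemma F_mean_value {H : Hilbert} (B : Operator H) (hl : linear_operator B) (s : R) (F : H -> R)
    (gradF : H -> H) (hF : nonlinearity B s F gradF) (w d : H) :
  dom B w -> dom B d ->
  exists c, 0 <= c <= 1 /\ F (plus w d) - F w = inner (gradF (plus w (scal c d))) d.
Proof.
  intros Hw Hd.
  assert (Hdom : forall c, dom B (plus w (scal c d))).
  { intros c. apply dom_plus; try assumption. apply dom_scal; assumption. }
  assert (Hder : forall c, is_derive (fun x => F (plus w (scal x d))) c (inner (gradF (plus w (scal c d))) d)).
  { intros c. apply is_derive_R_eps. intros eps Heps.
    set (K := norm d + norm (B d) + 1).
    assert (HK : 0 < K) by (unfold K; pose proof (norm_pos_H d); pose proof (norm_pos_H (B d)); lra).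
    destruct (F_diff _ _ _ _ hF _ (Hdom c) (eps / K)) as [e [He Hee]]; [now apply Rdiv_lt_0_compat|].
    exists (e / K). split; [now apply Rdiv_lt_0_compat|]. intros x Hx.
    assert (Hn : norm1 B (scal (x - c) d) <= Rabs (x - c) * K).
    { eapply Rle_trans; [apply norm1_le|]. rewrite (app_scal _ hl); [|exact Hd].
      pose proof (norm_scal_H (x - c) d). pose proof (norm_scal_H (x - c) (B d)).
      pose proof (Rabs_pos (x - c)). unfold K. lra. }
    specialize (Hee (scal (x - c) d)).
    replace (plus (plus w (scal c d)) (scal (x - c) d)) with (plus w (scal x d)) in Hee by vec_ring.
    rewrite inner_scal_r in Hee. eapply Rle_trans; [apply Hee|].
    - apply dom_scal; assumption.
    - apply Rle_lt_trans with (1 := Hn). apply (Rmult_lt_compat_r K) in Hx; [|exact HK].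
      replace (e / K * K) with e in Hx by (field; lra). exact Hx.
    - replace (eps * Rabs (x - c)) with (eps / K * (Rabs (x - c) * K)) by (field; lra).
      apply Rmult_le_compat_l; [|exact Hn]. left. now apply Rdiv_lt_0_compat. }
  destruct (MVT_gen (fun x => F (plus w (scal x d))) 0 1 (fun c => inner (gradF (plus w (scal c d))) d))
    as [c [Hc Hm]].
  - intros x _. apply Hder.
  - intros x _. apply continuity_pt_filterlim.
    apply (is_derive_continuous (V := R_NormedModule) (fun x => F (plus w (scal x d))) x _ (Hder x)).
  - rewrite Rmin_left in Hc; [|lra]. rewrite Rmax_right in Hc; [|lra].
    exists c. split; [exact Hc|].
    replace (plus w (scal 1 d)) with (plus w d) in Hm by vec_ring.
    replace (plus w (scal 0 d)) with w in Hm by vec_ring. lra.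
Qed.

(** [F] is differentiable in $H_1$, but [U] is differentiable only in $H$, so the chain rule does
    not apply: the remainder in [F_diff] is not $o(r-t)$. The mean value theorem on the segment from
    [U t] to [U r] avoids this, because it pairs [gradF], continuous from $H_1$ to $H$, with an
    increment measured in $H$. *)
Lemma F_derive {H : Hilbert} (B : Operator H) (hl : linear_operator B) (s : R) (F : H -> R)
    (gradF : H -> H) (hF : nonlinearity B s F gradF) (U : R -> H) (t : R) (V : H) :
  (forall r, dom B (U r)) -> continuous (fun r => B (U r)) t -> is_derive U t V ->
  is_derive (fun r => F (U r)) t (inner (gradF (U t)) V).
Proof.
  intros Hdom HB HU. apply is_derive_R_eps. intros eps Heps.
  pose proof (proj1 (is_derive_H_eps U t V) HU) as HU'.
  pose proof (proj1 (continuous_H_eps U t) (is_derive_continuous _ _ _ HU)) as HUc.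
  pose proof (proj1 (continuous_H_eps _ t) HB) as HBc.
  set (K := norm V + norm (gradF (U t)) + 1).
  assert (HK : 0 < K) by (unfold K; pose proof (norm_pos_H V); pose proof (norm_pos_H (gradF (U t))); lra).
  set (e := Rmin 1 (eps / (2 * K))).
  assert (He : 0 < e) by (apply Rmin_pos; [lra|apply Rdiv_lt_0_compat; lra]).
  assert (He1 : e <= 1) by apply Rmin_l.
  assert (He2 : e * K <= eps / 2).
  { replace (eps / 2) with (eps / (2 * K) * K) by (field; lra).
    apply Rmult_le_compat_r; [lra|apply Rmin_r]. }
  destruct (gradF_continuous B hl s F gradF hF (U t) e (Hdom t) He) as [d0 [Hd0 Hg]].
  destruct (HU' e He) as [d1 [Hd1 H1]]. destruct (HUc d0 Hd0) as [d2 [Hd2 H2]].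
  destruct (HBc d0 Hd0) as [d3 [Hd3 H3]].
  exists (Rmin d1 (Rmin d2 d3)). split; [repeat apply Rmin_pos; assumption|]. intros r Hr.
  pose proof (Rmin_l d1 (Rmin d2 d3)). pose proof (Rmin_r d1 (Rmin d2 d3)).
  pose proof (Rmin_l d2 d3). pose proof (Rmin_r d2 d3).
  specialize (H1 r ltac:(lra)). specialize (H2 r ltac:(lra)). specialize (H3 r ltac:(lra)).
  simpl in H3. rewrite -(proj2 (dom_minus B hl _ _ (Hdom r) (Hdom t))) in H3.
  assert (Hex : exists d : H, d = minus (U r) (U t)) by (eexists; reflexivity). destruct Hex as [d Hd].
  assert (Hdd : dom B d) by (rewrite Hd; apply (dom_minus B hl); apply Hdom).
  destruct (F_mean_value B hl s F gradF hF (U t) d (Hdom t) Hdd) as [c [Hc Hm]].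
  replace (plus (U t) d) with (U r) in Hm by (rewrite Hd; vec_ring).
  rewrite Hm. rewrite -Hd in H1 H2 H3.
  assert (Hgc : norm (minus (gradF (plus (U t) (scal c d))) (gradF (U t))) <= e).
  { assert (Hx : minus (plus (U t) (scal c d)) (U t) = scal c d) by vec_ring.
    apply Hg.
    - apply dom_plus; [assumption|apply Hdom|]. apply dom_scal; assumption.
    - rewrite Hx. eapply Rle_trans; [apply norm_scal_H|]. rewrite Rabs_pos_eq; [|lra].
      pose proof (norm_pos_H d). nra.
    - rewrite Hx (app_scal _ hl); [|exact Hdd].
      eapply Rle_trans; [apply norm_scal_H|]. rewrite Rabs_pos_eq; [|lra].
      pose proof (norm_pos_H (B d)). nra. }
  set (h := Rabs (r - t)) in *. assert (Hh : 0 <= h) by apply Rabs_pos.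
  assert (Hdn : norm d <= h * (norm V + 1)).
  { pose proof (norm_minus_le d (scal (r - t) V)) as C1. pose proof (norm_scal_H (r - t) V) as C2.
    fold h in C2. assert (e * h <= 1 * h) by (apply Rmult_le_compat_r; lra).
    lra. }
  replace (inner (gradF (plus (U t) (scal c d))) d - (r - t) * inner (gradF (U t)) V)
    with (inner (minus (gradF (plus (U t) (scal c d))) (gradF (U t))) d
          + inner (gradF (U t)) (minus d (scal (r - t) V))) by (rewrite !inner_minus_l inner_minus_r inner_scal_r; ring).
  eapply Rle_trans; [apply Rabs_triang|].
  pose proof (cauchy_schwarz (minus (gradF (plus (U t) (scal c d))) (gradF (U t))) d) as C3.
  pose proof (cauchy_schwarz (gradF (U t)) (minus d (scal (r - t) V))) as C4.
  pose proof (norm_pos_H (gradF (U t))). pose proof (norm_pos_H V).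
  assert (D1 : norm (minus (gradF (plus (U t) (scal c d))) (gradF (U t))) * norm d <= e * (h * (norm V + 1)))
    by (apply Rmult_le_compat; [apply norm_pos_H|apply norm_pos_H|assumption|assumption]).
  assert (D2 : norm (gradF (U t)) * norm (minus d (scal (r - t) V)) <= norm (gradF (U t)) * (e * h))
    by (apply Rmult_le_compat_l; assumption).
  assert (D3 : e * K * h <= eps / 2 * h) by (apply Rmult_le_compat_r; assumption).
  assert (0 <= eps * h) by (apply Rmult_le_pos; lra).
  unfold K in D3. lra.
Qed.

(** [F] is nonnegative and vanishes at 0, so 0 is a minimum and the derivative there is zero. *)
Lemma inner_gradF_0 {H : Hilbert} (B : Operator H) (hl : linear_operator B) (s : R) (F : H -> R)
    (gradF : H -> H) (hF : nonlinearity B s F gradF) (v : H) :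
  dom B v -> inner (gradF zero) v = 0.
Proof.
  assert (Hle : forall v, dom B v -> 0 <= inner (gradF zero) v).
  { intros w Hw. apply Rnot_lt_le. intros Hlt.
    set (K := norm w + norm (B w) + 1).
    assert (HK : 0 < K) by (unfold K; pose proof (norm_pos_H w); pose proof (norm_pos_H (B w)); lra).
    (* The tolerance is half the negative slope, scaled by [K], so that [F (scal x w)] would be at
       most half of the negative linear term. *)
    destruct (F_diff _ _ _ _ hF _ (dom_zero _ hl) (- inner (gradF zero) w / (2 * K))) as [e [He Hee]].
    { apply Rdiv_lt_0_compat; lra. }
    set (x := e / (2 * K)). assert (Hx : 0 < x) by (apply Rdiv_lt_0_compat; lra).
    assert (Hdx : dom B (scal x w)) by (apply dom_scal; assumption).
    assert (Hn : norm1 B (scal x w) <= x * K).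
    { eapply Rle_trans; [apply norm1_le|]. rewrite (app_scal _ hl); [|exact Hw].
      pose proof (norm_scal_H x w) as N1. pose proof (norm_scal_H x (B w)) as N2.
      rewrite (Rabs_pos_eq x) in N1 N2; [|lra..]. unfold K. lra. }
    assert (HxK : x * K = e / 2) by (unfold x; field; lra).
    specialize (Hee (scal x w) Hdx ltac:(lra)).
    rewrite (F_zero _ _ _ _ hF) inner_scal_r in Hee.
    assert (Hpz : plus zero (scal x w) = scal x w) by vec_ring.
    rewrite Hpz in Hee.
    pose proof (F_nonneg _ _ _ _ hF _ Hdx) as Hp.
    pose proof (Rle_abs (F (scal x w) - 0 - x * inner (gradF zero) w)) as Ha.
    assert (Hb : - inner (gradF zero) w / (2 * K) * norm1 B (scal x w)
      <= - inner (gradF zero) w / (2 * K) * (x * K)).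
    { apply Rmult_le_compat_l; [|exact Hn]. left. apply Rdiv_lt_0_compat; lra. }
    replace (- inner (gradF zero) w / (2 * K) * (x * K)) with (- (x * inner (gradF zero) w) / 2) in Hb
      by (field; lra).
    assert (x * inner (gradF zero) w < 0) by nra. lra. }
  intros Hv. pose proof (Hle v Hv) as H1.
  pose proof (Hle (scal (-1) v) (dom_scal _ hl _ _ Hv)) as H2. rewrite inner_scal_r in H2. lra.
Qed.

(** The growth condition compared with [w = 0], where the power vanishes and the gradient drops out
    after pairing with [v]. *)
Lemma inner_gradF_le {H : Hilbert} (B : Operator H) (hl : linear_operator B) (s : R) (F : H -> R)
    (gradF : H -> H) (hF : nonlinearity B s F gradF) :
  exists L1, 0 < L1 /\ forall v, dom B v ->
    inner (gradF v) v <= L1 * norm1 B v ^ 2 * rpow (norm1 B v) (s - 2).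
Proof.
  destruct (gradF_growth _ _ _ _ hF) as [L1 [HL1 HL]]. exists L1. split; [exact HL1|].
  intros v Hv. specialize (HL v zero Hv (dom_zero _ hl)).
  assert (Hz : norm1 B zero = 0).
  { unfold norm1. rewrite (app_zero B hl) -!inner_norm inner_zero_l Rplus_0_r. apply sqrt_0. }
  assert (Hr : rpow (norm1 B zero) (s - 2) = 0).
  { rewrite Hz. unfold rpow. destruct (Req_EM_T 0 0); [reflexivity|contradiction]. }
  rewrite Hr Rplus_0_r in HL.
  assert (Hmz : minus v zero = v) by vec_ring. rewrite Hmz in HL.
  pose proof (inner_gradF_0 B hl s F gradF hF v Hv) as H0.
  pose proof (cauchy_schwarz (minus (gradF v) (gradF zero)) v) as C.
  pose proof (Rle_abs (inner (minus (gradF v) (gradF zero)) v)) as C2.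
  rewrite inner_minus_l H0 Rminus_0_r in C C2.
  apply Rle_trans with (1 := C2). apply Rle_trans with (1 := C).
  apply Rle_trans with (L1 * norm1 B v * rpow (norm1 B v) (s - 2) * norm1 B v); [|right; ring].
  apply Rmult_le_compat; [apply norm_pos_H|apply norm_pos_H|exact HL|apply norm_le_norm1].
Qed.

(** * From mild to weak solutions *)

Lemma Rmax_lipschitz (t0 r t : R) : Rabs (Rmax t0 r - Rmax t0 t) <= Rabs (r - t).
Proof.
  unfold Rmax, Rabs. repeat destruct Rle_dec; repeat destruct Rcase_abs; lra.
Qed.

Lemma filterlim_clamp (t0 t : R) :
  filterlim (fun r => Rmax t0 r) (locally t) (within (fun r => t0 <= r) (locally (Rmax t0 t))).
Proof.
  intros P [d Hd]. exists d. intros r Hr. apply Hd; [|apply Rmax_l].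
  eapply Rle_lt_trans; [apply Rmax_lipschitz|exact Hr].
Qed.

Lemma continuous_clamp (t0 t : R) : continuous (fun r => Rmax t0 r) t.
Proof.
  apply continuous_R_eps. intros eps Heps. exists eps. split; [exact Heps|]. intros r Hr.
  eapply Rle_lt_trans; [apply Rmax_lipschitz|exact Hr].
Qed.

(** The clamp in the denominator keeps the damping coefficient continuous on the whole line when
    [t0 > 0]; for [r >= t0] it is [alpha / r]. *)
Definition forcing {H : Hilbert} (gradF : H -> H) (alpha t0 : R) (U V : R -> H) (r : R) : H :=
  plus (scal (alpha / Rmax t0 r) (V r)) (gradF (U r)).

(* Extending [u] and [du] by their initial values to the left of [t0] gives
   functions that are continuous on the whole line. *)
Lemma mild_weak_solution {H : Hilbert} (A B : Operator H) (F : H -> R) (gradF : H -> H)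
    (Sol dSol : R -> H -> H) (s alpha t0 : R)
    (hA : self_adjoint A) (hA0 : nonneg_operator A) (hB : is_sqrt_operator A B)
    (hF : nonlinearity B s F gradF) (hS : solution_operator A B Sol dSol) (ht0 : 0 < t0)
    (u0 u1 : H) (u du : R -> H) (hm : mild_solution B gradF Sol dSol alpha t0 u0 u1 u du) :
  let U := fun r => u (Rmax t0 r) in
  let V := fun r => du (Rmax t0 r) in
  weak_solution A B t0 U V (forcing gradF alpha t0 U V) /\ u t0 = u0 /\ du t0 = u1.
Proof.
  intros U V. set (f := forcing gradF alpha t0 U V).
  pose proof (sa_linear _ (sqrt_self_adjoint _ _ hB)) as hl.
  assert (Hdom : forall t, dom B (U t)).
  { intros t. apply (mild_dom _ _ _ _ _ _ _ _ _ _ hm). apply Rmax_l. }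
  assert (HV : forall t, continuous V t).
  { intros t. apply (filterlim_comp _ _ _ (fun r => Rmax t0 r) du _ _ _ (filterlim_clamp t0 t)).
    apply (mild_C1 _ _ _ _ _ _ _ _ _ _ hm). apply Rmax_l. }
  assert (HN : forall t eps, 0 < eps -> exists d, 0 < d /\ forall r, Rabs (r - t) < d ->
    norm1 B (minus (U r) (U t)) < eps).
  { intros t eps Heps.
    pose proof (filterlim_comp _ _ _ (fun r => Rmax t0 r) _ _ _ _ (filterlim_clamp t0 t)
      (mild_continuous _ _ _ _ _ _ _ _ _ _ hm (Rmax t0 t) (Rmax_l _ _))) as Hl.
    destruct (Hl (fun y => Rabs (y - 0) < eps)) as [d Hd].
    { exists (mkposreal _ Heps). intros y Hy. exact Hy. }
    exists d. split; [apply cond_pos|]. intros r Hr. specialize (Hd r Hr). simpl in Hd.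
    eapply Rle_lt_trans; [|exact Hd]. rewrite Rminus_0_r. apply Rle_abs. }
  assert (HU : forall t, continuous U t).
  { intros t. apply continuous_H_eps. intros eps Heps. destruct (HN t eps Heps) as [d [Hd Hd']].
    exists d. split; [exact Hd|]. intros r Hr.
    eapply Rle_lt_trans; [apply (norm_le_norm1 B)|]. apply Hd', Hr. }
  assert (HBU : forall t, continuous (fun r => B (U r)) t).
  { intros t. apply continuous_H_eps. intros eps Heps. destruct (HN t eps Heps) as [d [Hd Hd']].
    exists d. split; [exact Hd|]. intros r Hr.
    rewrite -(proj2 (dom_minus B hl _ _ (Hdom r) (Hdom t))).
    eapply Rle_lt_trans; [apply norm_B_le_norm1|]. apply Hd', Hr. }
  assert (Hf : forall t, continuous f t).
  { intros t. apply (continuous_plus (fun r => scal (alpha / Rmax t0 r) (V r)) (fun r => gradF (U r))).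
    - apply (continuous_scal (fun r => alpha / Rmax t0 r) V); [|apply HV].
      apply (continuous_mult (K := R_AbsRing) (fun _ => alpha) (fun r => / Rmax t0 r)); [apply continuous_const|].
      apply (continuous_comp (fun r => Rmax t0 r) Rinv); [apply continuous_clamp|].
      apply continuity_pt_filterlim. apply (continuity_pt_inv id); [apply derivable_continuous_pt, derivable_pt_id|].
      pose proof (Rmax_l t0 t). unfold id. lra.
    - apply continuous_H_eps. intros eps Heps.
      destruct (gradF_continuous B hl s F gradF hF (U t) (eps / 2) (Hdom t) ltac:(lra)) as [d [Hd Hd']].
      destruct (HN t d Hd) as [e [He He']]. exists e. split; [exact He|]. intros r Hr.
      specialize (He' r Hr).
      pose proof (norm_le_norm1 B (minus (U r) (U t))). pose proof (norm_B_le_norm1 B (minus (U r) (U t))).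
      eapply Rle_lt_trans; [apply Hd'; [apply Hdom|lra|lra]|lra]. }
  assert (Hloc : forall t, t0 < t -> locally t (fun r => t0 < r)).
  { intros t Ht. exists (mkposreal (t - t0) ltac:(lra)). intros r Hr.
    change (Rabs (r - t) < t - t0) in Hr. apply Rabs_def2 in Hr. lra. }
  assert (HdU : forall t, t0 < t -> is_derive U t (V t)).
  { intros t Ht. apply (is_derive_ext_loc u).
    { generalize (Hloc t Ht). apply filter_imp. intros r Hr. unfold U. rewrite Rmax_right; [reflexivity|lra]. }
    unfold V. rewrite Rmax_right; [|lra].
    destruct (mild_derive _ _ _ _ _ _ _ _ _ _ hm t ltac:(lra)) as [_ Hd].
    apply is_derive_H_eps. intros eps Heps.
    specialize (Hd t).
    assert (Hlim : is_filter_lim (within (fun r => t0 <= r) (locally t)) t).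
    { intros P HP. apply filter_le_within, HP. }
    destruct (Hd Hlim (mkposreal _ Heps)) as [d Hd'].
    destruct (Hloc t Ht) as [d2 Hd2].
    exists (Rmin d d2). split; [apply Rmin_pos; apply cond_pos|]. intros r Hr.
    apply (Hd' r).
    - eapply Rlt_le_trans; [exact Hr|apply Rmin_l].
    - left. apply (Hd2 r). eapply Rlt_le_trans; [exact Hr|apply Rmin_r]. }
  assert (Hmild : forall t, t0 <= t -> U t = mild_map Sol dSol f t0 u0 u1 t).
  { intros t Ht. unfold U. rewrite Rmax_right; [|lra].
    rewrite (mild_formula _ _ _ _ _ _ _ _ _ _ hm t Ht). unfold mild_map. f_equal.
    apply RInt_ext. intros x Hx. rewrite Rmin_left in Hx; [|lra].
    unfold f, forcing, U, V. rewrite Rmax_right; [|lra]. reflexivity. }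
  (* After [t0] both [inner (V t) z] and [q] are the derivative of [inner (U t) z]; [q] carries the
     differential equation and the value at [t0]. *)
  assert (Hq : forall z, dom A z -> exists q : R -> R,
    (forall t, t0 < t -> inner (V t) z = q t) /\
    (forall t, is_derive q t (- inner (mild_map Sol dSol f t0 u0 u1 t) (A z) - inner (f t) z)) /\
    q t0 = inner u1 z).
  { intros z Hz.
    destruct (mild_map_weak A B Sol dSol hA hA0 hB hS f t0 u0 u1 z Hf Hz) as [q [Q1 [Q2 Q3]]].
    exists q. split; [|split; assumption]. intros t Ht.
    pose proof (is_derive_inner_l U t (V t) z (HdU t Ht)) as D1.
    rewrite -(is_derive_unique _ _ _ D1) -(is_derive_unique _ _ _ (Q1 t)).
    apply Derive_ext_loc. generalize (Hloc t Ht). apply filter_imp. intros r Hr.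
    rewrite Hmild; [reflexivity|lra]. }
  split; [|split].
  - constructor; try assumption. intros z t Hz Ht. destruct (Hq z Hz) as [q [Q1 [Q2 _]]].
    rewrite (Hmild t ltac:(lra)). apply (is_derive_ext_loc q); [|apply Q2].
    generalize (Hloc t Ht). apply filter_imp. intros r Hr. symmetry. apply Q1, Hr.
  - rewrite (mild_formula _ _ _ _ _ _ _ _ _ _ hm t0 (Rle_refl _)).
    rewrite Rminus_diag (dSol_0 _ _ _ _ hS) (Sol_0 _ _ _ _ hS) RInt_point. vec_ring.
  (* The initial velocity is recovered from the formula: [inner (V r) z] and [q] agree to the right
     of [t0] and are continuous at [t0]. *)
  - replace (du t0) with (V t0) by (unfold V; rewrite Rmax_left; [reflexivity|lra]).
    apply (dense_inner_ext A (sa_dense _ hA)). intros z Hz.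
    destruct (Hq z Hz) as [q [Q1 [Q2 Q3]]]. rewrite -Q3.
    assert (Hc : continuous (fun r => inner (V r) z - q r) t0).
    { apply (continuous_minus (fun r => inner (V r) z) q).
      - apply continuous_inner; [apply HV|apply continuous_const].
      - apply (is_derive_continuous (V := R_NormedModule) _ _ _ (Q2 t0)). }
    destruct (Req_dec (inner (V t0) z - q t0) 0) as [H0|H0]; [lra|exfalso].
    destruct (proj1 (continuous_R_eps _ t0) Hc (Rabs (inner (V t0) z - q t0)) (Rabs_pos_lt _ H0)) as [d [Hd Hd']].
    specialize (Hd' (t0 + d / 2)). rewrite (Q1 (t0 + d / 2)) in Hd'; [|lra].
    replace (t0 + d / 2 - t0) with (d / 2) in Hd' by ring.
    rewrite Rabs_pos_eq in Hd'; [|lra]. specialize (Hd' ltac:(lra)).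
    rewrite Rminus_diag Rminus_0_l Rabs_Ropp in Hd'. lra.
Qed.

(** * Decay of the energy *)

Lemma exp_le_compat (x y : R) : x <= y -> exp x <= exp y.
Proof. intros [Hlt| ->]; [left; apply exp_increasing, Hlt|right; reflexivity]. Qed.

(** Gronwall's inequality with integrating factor [exp (phi t)]. At the end points only continuity
    of [G] is asked, since the energy is differentiated only after [t0]. *)
Lemma exp_factor_le (G dG phi dphi : R -> R) (x y : R) :
  x <= y ->
  (forall t, x <= t <= y -> is_derive phi t (dphi t)) ->
  (forall t, x < t < y -> is_derive G t (dG t)) ->
  (forall t, x <= t <= y -> continuous G t) ->
  (forall t, x <= t <= y -> 0 <= dphi t * G t + dG t) ->
  exp (phi x) * G x <= exp (phi y) * G y.
Proof.
  intros Hxy Hphi HG Hc Hpos.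
  assert (Hexp : forall t, x <= t <= y -> is_derive (fun t => exp (phi t)) t (dphi t * exp (phi t))).
  { intros t Ht. apply (is_derive_comp exp phi t (exp (phi t)) (dphi t)); [apply is_derive_exp|apply Hphi, Ht]. }
  destruct (MVT_gen (fun t => exp (phi t) * G t) x y (fun t => exp (phi t) * (dphi t * G t + dG t)))
    as [c [Hc1 Hc2]].
  - intros t. rewrite Rmin_left; [|exact Hxy]. rewrite Rmax_right; [|exact Hxy]. intros Ht.
    apply (is_derive_Rval _ _ _ _ (is_derive_Rmult _ _ _ _ _ (Hexp t ltac:(lra)) (HG t Ht))). ring.
  - intros t. rewrite Rmin_left; [|exact Hxy]. rewrite Rmax_right; [|exact Hxy]. intros Ht.
    apply continuity_pt_filterlim. apply (continuous_mult (K := R_AbsRing) (fun t => exp (phi t)) G).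
    + apply (is_derive_continuous (V := R_NormedModule) _ _ _ (Hexp t Ht)).
    + apply Hc, Ht.
  - rewrite Rmin_left in Hc1; [|exact Hxy]. rewrite Rmax_right in Hc1; [|exact Hxy].
    pose proof (Hpos c Hc1) as Hp. pose proof (exp_pos (phi c)) as He.
    assert (0 <= exp (phi c) * (dphi c * G c + dG c) * (y - x)) by
      (apply Rmult_le_pos; [apply Rmult_le_pos|]; lra).
    lra.
Qed.

Lemma exp_factor_ge (G dG phi dphi : R -> R) (x y : R) :
  x <= y ->
  (forall t, x <= t <= y -> is_derive phi t (dphi t)) ->
  (forall t, x < t < y -> is_derive G t (dG t)) ->
  (forall t, x <= t <= y -> continuous G t) ->
  (forall t, x <= t <= y -> dphi t * G t + dG t <= 0) ->
  exp (phi y) * G y <= exp (phi x) * G x.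
Proof.
  intros Hxy Hphi HG Hc Hneg.
  pose proof (exp_factor_le (fun t => - G t) (fun t => - dG t) phi dphi x y Hxy Hphi) as Hle.
  apply Ropp_le_cancel. rewrite !Ropp_mult_distr_r. apply Hle.
  - intros t Ht. apply (is_derive_opp G), HG, Ht.
  - intros t Ht. apply (continuous_opp G), Hc, Ht.
  - intros t Ht. specialize (Hneg t Ht). lra.
Qed.

(** Reduces the problem to real functions: $a=\|u'\|^2$, $b=\|A^{1/2}u\|^2$, $c=\langle
    u',u\rangle$, $p=\langle\nabla F(u),u\rangle$. The growth bound takes any positive majorant [m]
    of the energy instead of the energy itself, which may be zero, where [Rpower] is not the
    intended power. *)
Record energy_balance (alpha t0 c0 Kp sigma : R) (a b Fv c p : R -> R) : Prop := {
  eb_a : forall t, t0 <= t -> 0 <= a t;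
  eb_b : forall t, t0 <= t -> 0 <= b t;
  eb_F : forall t, t0 <= t -> 0 <= Fv t;
  eb_c : forall t, t0 <= t -> Rabs (c t) <= c0 * (a t / 2 + b t / 2 + Fv t);
  eb_p_lower : forall t, t0 <= t -> 2 * Fv t <= p t;
  eb_p_upper : forall t m, t0 <= t -> 0 < m -> a t / 2 + b t / 2 + Fv t <= m ->
    p t <= Kp * (a t / 2 + b t / 2 + Fv t) * Rpower m sigma;
  eb_continuous : forall t, t0 <= t -> continuous (fun r => a r / 2 + b r / 2 + Fv r) t;
  eb_E : forall t, t0 < t -> is_derive (fun r => a r / 2 + b r / 2 + Fv r) t (- (alpha / t) * a t);
  eb_c_derive : forall t, t0 < t -> is_derive c t (a t - b t - alpha / t * c t - p t)
}.

Lemma energy_balance_lower_bound (alpha t0 c0 Kp sigma E0 : R) :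
  0 < alpha -> 0 < t0 -> 0 <= c0 -> 0 <= Kp -> 0 < sigma -> 0 <= E0 ->
  exists T C, t0 <= T /\ 0 < C /\
    forall a b Fv c p, energy_balance alpha t0 c0 Kp sigma a b Fv c p ->
      a t0 / 2 + b t0 / 2 + Fv t0 = E0 ->
      forall t, T <= t -> E0 * C * Rpower t (- alpha) <= a t / 2 + b t / 2 + Fv t.
Proof.
  intros Ha Ht0 Hc0 HKp Hsig HE0.
  set (k := alpha * c0 / 2). assert (Hk : 0 <= k) by (unfold k; nra).
  (* From this time on $\alpha c_0/t\le1$, so the cross term in [G] is at most half the energy. *)
  set (T := t0 + 1 + alpha * c0). assert (HT : t0 < T) by (unfold T; nra).
  (* The constant in $E\le Mt^{-\alpha}$: the 3 is $2\cdot\frac32$, from comparing [G] with the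
     energy at both ends, and [E0 + 1] keeps [M] positive so that its real power is meaningful. *)
  set (M := 3 * (E0 + 1) * exp (alpha * ln T + 2 * k / T)).
  assert (HM : 0 < M) by (apply Rmult_lt_0_compat; [lra|apply exp_pos]).
  set (Q := alpha * Kp * Rpower M sigma).
  assert (HQ : 0 <= Q).
  { apply Rmult_le_pos; [nra|]. left. apply exp_pos. }
  (* A primitive of $\alpha/t+2k/t^2+Qt^{-1-\alpha\sigma}$. The last two terms are integrable at
     infinity, so [phi] differs from [alpha * ln t] by a bounded, nonpositive amount. *)
  set (phi := fun t => alpha * ln t - 2 * k / t - Q / (alpha * sigma) * exp (- (alpha * sigma) * ln t)).
  (* The 4 collects [E T <= 2 * G T] and [G t <= 2 * E t]; the last factor is $(t_0/T)^{2\alpha}$,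
     the most that the energy can lose up to [T]. *)
  exists T, (exp (phi T) / 4 * exp (2 * alpha * ln t0 - 2 * alpha * ln T)).
  split; [lra|]. split.
  { apply Rmult_lt_0_compat; [|apply exp_pos]. pose proof (exp_pos (phi T)). lra. }
  intros a b Fv c p [Pa Pb PF Pc Pp1 Pp2 Pcont PE Pcd] HEt0.
  set (E := fun r => a r / 2 + b r / 2 + Fv r) in *.
  change (forall t, T <= t -> E0 * (exp (phi T) / 4 * exp (2 * alpha * ln t0 - 2 * alpha * ln T)) *
    Rpower t (- alpha) <= E t).
  change (E t0 = E0) in HEt0.
  assert (HEa : forall t, t0 <= t -> 0 <= a t <= 2 * E t).
  { intros t Ht. unfold E. specialize (Pa t Ht). specialize (Pb t Ht). specialize (PF t Ht). lra. }
  assert (Hinv : forall t, t0 <= t -> 0 < / t) by (intros t Ht; apply Rinv_0_lt_compat; lra).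
  assert (Hln : forall t, t0 <= t -> is_derive ln t (/ t)) by (intros t Ht; apply is_derive_ln; lra).
  assert (HET : E T <= E0).
  { rewrite -HEt0.
    pose proof (exp_factor_ge E (fun t => - (alpha / t) * a t) (fun _ => 0) (fun _ => 0) t0 T ltac:(lra)) as Hf.
    rewrite exp_0 !Rmult_1_l in Hf. apply Hf.
    - intros t _. apply is_derive_Rconst.
    - intros t Ht. apply PE. lra.
    - intros t Ht. apply Pcont. lra.
    - intros t Ht. specialize (HEa t ltac:(lra)). specialize (Hinv t ltac:(lra)). unfold Rdiv.
      assert (0 <= alpha * / t * a t) by (apply Rmult_le_pos; [nra|lra]). lra. }
  (* Since [a t <= 2 * E t], the energy decays at most like $t^{-2\alpha}$. *)
  assert (HET2 : exp (2 * alpha * ln t0) * E0 <= exp (2 * alpha * ln T) * E T).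
  { rewrite -HEt0.
    apply (exp_factor_le E (fun t => - (alpha / t) * a t) (fun t => 2 * alpha * ln t) (fun t => 2 * alpha * / t));
      [lra| | | |].
    - intros t Ht. apply is_derive_Rscal, Hln. lra.
    - intros t Ht. apply PE. lra.
    - intros t Ht. apply Pcont. lra.
    - intros t Ht. specialize (HEa t ltac:(lra)). specialize (Hinv t ltac:(lra)). unfold Rdiv.
      replace (2 * alpha * / t * E t + - (alpha * / t) * a t) with (alpha * / t * (2 * E t - a t)) by ring.
      apply Rmult_le_pos; [nra|lra]. }
  set (G := fun t => E t + alpha / 2 * (/ t * c t)).
  set (dG := fun t => - (alpha / t) * a t + alpha / 2 * (- / t ^ 2 * c t + / t * (a t - b t - alpha / t * c t - p t))).
  assert (HdG : forall t, t0 < t -> is_derive G t (dG t)).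
  { intros t Ht. apply is_derive_Rplus; [apply PE, Ht|]. apply is_derive_Rscal.
    apply (is_derive_Rmult (fun t => / t) c); [|apply Pcd, Ht].
    auto_derive; [lra|]. field. lra. }
  assert (HGc : forall t, t0 < t -> continuous G t).
  { intros t Ht. apply (is_derive_continuous (V := R_NormedModule) _ _ _ (HdG t Ht)). }
  (* The damping term $-(\alpha^2/2t^2)c$ coming from $c'$ is exactly the cross term of
     $-(\alpha/t)G$, so only the derivative of the weight $1/t$ leaves a remainder in $c$. *)
  assert (HdG2 : forall t, t0 <= t ->
    dG t = - (alpha * / t) * G t - alpha / 2 * c t * (/ t) ^ 2 - alpha * / t * (p t / 2 - Fv t)).
  { intros t Ht. unfold dG, G, E. field. lra. }
  assert (HGE : forall t, T <= t -> E t / 2 <= G t <= 3 / 2 * E t).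
  { intros t Ht. specialize (Pc t ltac:(lra)). change (Rabs (c t) <= c0 * E t) in Pc.
    specialize (HEa t ltac:(lra)). specialize (Hinv t ltac:(lra)).
    assert (H1 : Rabs (alpha / 2 * (/ t * c t)) <= E t / 2).
    { rewrite Rabs_mult (Rabs_pos_eq (alpha / 2)); [|lra]. rewrite Rabs_mult (Rabs_pos_eq (/ t)); [|lra].
      assert (H2 : / t * (alpha * c0) <= 1).
      { apply (Rmult_le_reg_l t); [lra|]. rewrite -Rmult_assoc Rinv_r; [|lra]. unfold T in Ht. lra. }
      apply Rle_trans with (alpha / 2 * (/ t * (c0 * E t))).
      - apply Rmult_le_compat_l; [lra|]. apply Rmult_le_compat_l; lra.
      - replace (alpha / 2 * (/ t * (c0 * E t))) with (/ t * (alpha * c0) * (E t / 2)) by (field; lra).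
        apply Rle_trans with (1 * (E t / 2)); [|lra]. apply Rmult_le_compat_r; lra. }
    apply Rabs_le_between in H1. unfold G. lra. }
  assert (Hc2 : forall t, T <= t -> Rabs (alpha / 2 * c t) <= 2 * k * G t).
  { intros t Ht. specialize (Pc t ltac:(lra)). change (Rabs (c t) <= c0 * E t) in Pc.
    specialize (HGE t Ht). rewrite Rabs_mult (Rabs_pos_eq (alpha / 2)); [|lra].
    apply Rle_trans with (alpha / 2 * (c0 * E t)); [apply Rmult_le_compat_l; lra|].
    replace (alpha / 2 * (c0 * E t)) with (k * E t) by (unfold k; field).
    rewrite (Rmult_comm 2) Rmult_assoc. apply Rmult_le_compat_l; lra. }
  assert (Hup : forall t, T <= t -> E t <= M * exp (- alpha * ln t)).
  { intros t Ht.
    assert (Hf : exp (alpha * ln t + 2 * k * / t) * G t <= exp (alpha * ln T + 2 * k * / T) * G T).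
    (* The correction [2 * k * / t] has derivative $-2k/t^2$, which absorbs the remainder in $c$;
       the bracket with [p] has the favourable sign. *)
    { apply (exp_factor_ge G dG (fun t => alpha * ln t + 2 * k * / t)
        (fun t => alpha * / t + 2 * k * - (/ t) ^ 2)); [exact Ht| | | |].
      - intros r Hr. apply is_derive_Rplus; [apply is_derive_Rscal, Hln; lra|].
        apply is_derive_Rscal. auto_derive; [lra|]. field. lra.
      - intros r Hr. apply HdG. lra.
      - intros r Hr. apply HGc. lra.
      - intros r Hr. rewrite HdG2; [|lra]. specialize (Hc2 r ltac:(lra)). apply Rabs_le_between in Hc2.
        specialize (Pp1 r ltac:(lra)). specialize (Hinv r ltac:(lra)). pose proof (pow2_ge_0 (/ r)).
        assert (0 <= alpha * / r * (p r / 2 - Fv r)) by (apply Rmult_le_pos; [nra|lra]).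
        assert (0 <= (/ r) ^ 2 * (2 * k * G r + alpha / 2 * c r)) by (apply Rmult_le_pos; lra).
        lra. }
    pose proof (HGE t Ht) as Hg1. pose proof (HGE T (Rle_refl _)) as Hg2.
    specialize (Hinv t ltac:(lra)).
    assert (H1 : exp (alpha * ln t) * G t <= exp (alpha * ln t + 2 * k * / t) * G t).
    { apply Rmult_le_compat_r; [specialize (HEa t ltac:(lra)); lra|].
      apply exp_le_compat. assert (0 <= 2 * k * / t) by (apply Rmult_le_pos; lra). lra. }
    assert (H2 : exp (alpha * ln T + 2 * k * / T) * G T <= exp (alpha * ln T + 2 * k * / T) * (3 / 2 * (E0 + 1))).
    { apply Rmult_le_compat_l; [left; apply exp_pos|lra]. }
    assert (H3 : exp (alpha * ln t) * E t <= M).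
    { unfold M. pose proof (exp_pos (alpha * ln t)).
      assert (exp (alpha * ln t) * (E t / 2) <= exp (alpha * ln t) * G t) by (apply Rmult_le_compat_l; lra).
      change (2 * k / T) with (2 * k * / T). lra. }
    apply (Rmult_le_compat_l (exp (- alpha * ln t))) in H3; [|left; apply exp_pos].
    rewrite -Rmult_assoc -exp_plus in H3.
    replace (- alpha * ln t + alpha * ln t) with 0 in H3 by ring. rewrite exp_0 in H3. lra. }
  (* With $m=Mt^{-\alpha}$ in the growth bound, the nonlinear term is at most
     $Qt^{-1-\alpha\sigma}G$, an integrable multiple of [G]. *)
  assert (Hp : forall t, T <= t -> alpha * / t * (p t / 2 - Fv t) <= Q * / t * exp (- (alpha * sigma) * ln t) * G t).
  { intros t Ht. specialize (Hinv t ltac:(lra)).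
    assert (Hm : 0 < M * exp (- alpha * ln t)) by (apply Rmult_lt_0_compat; [exact HM|apply exp_pos]).
    pose proof (Pp2 t _ ltac:(lra) Hm (Hup t Ht)) as Hpu. change (p t <= Kp * E t * Rpower (M * exp (- alpha * ln t)) sigma) in Hpu.
    rewrite -Rpower_mult_distr in Hpu; [|exact HM|apply exp_pos].
    replace (Rpower (exp (- alpha * ln t)) sigma) with (exp (- (alpha * sigma) * ln t)) in Hpu
      by (unfold Rpower; rewrite ln_exp; f_equal; ring).
    specialize (PF t ltac:(lra)). specialize (HGE t Ht).
    set (e := exp (- (alpha * sigma) * ln t)) in *. assert (He : 0 < e) by apply exp_pos.
    assert (HP : 0 < Rpower M sigma) by apply exp_pos.
    assert (H1 : p t / 2 - Fv t <= Kp * Rpower M sigma * e * G t).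
    { apply Rle_trans with (Kp * Rpower M sigma * e * (E t / 2)); [lra|].
      apply Rmult_le_compat_l; [|lra]. apply Rmult_le_pos; [apply Rmult_le_pos; lra|lra]. }
    apply (Rmult_le_compat_l (alpha * / t)) in H1; [|nra]. unfold Q. lra. }
  intros t Ht.
  assert (Hf : exp (phi T) * G T <= exp (phi t) * G t).
  { apply (exp_factor_le G dG phi
      (fun t => alpha * / t + 2 * k * (/ t) ^ 2 + Q * / t * exp (- (alpha * sigma) * ln t))); [exact Ht| | | |].
    - intros r Hr. unfold phi. auto_derive; [lra|]. field. lra.
    - intros r Hr. apply HdG. lra.
    - intros r Hr. apply HGc. lra.
    - intros r Hr. rewrite HdG2; [|lra]. specialize (Hc2 r ltac:(lra)). apply Rabs_le_between in Hc2.
      specialize (Hp r ltac:(lra)). pose proof (pow2_ge_0 (/ r)).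
      assert (0 <= (/ r) ^ 2 * (2 * k * G r - alpha / 2 * c r)) by (apply Rmult_le_pos; lra).
      lra. }
  pose proof (HGE t Ht) as Hg1. pose proof (HGE T (Rle_refl _)) as Hg2.
  pose proof (HEa t ltac:(lra)) as HEt.
  assert (H1 : exp (phi t) * G t <= exp (alpha * ln t) * (2 * E t)).
  { apply Rmult_le_compat; [left; apply exp_pos|lra| |lra].
    apply exp_le_compat. unfold phi. specialize (Hinv t ltac:(lra)).
    assert (0 <= 2 * k / t) by (apply Rmult_le_pos; lra).
    assert (0 <= Q / (alpha * sigma) * exp (- (alpha * sigma) * ln t)).
    { apply Rmult_le_pos; [|left; apply exp_pos]. apply Rmult_le_pos; [exact HQ|].
      left. apply Rinv_0_lt_compat. nra. }
    lra. }
  assert (H2 : exp (2 * alpha * ln t0 - 2 * alpha * ln T) * E0 <= E T).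
  { apply (Rmult_le_compat_l (exp (- (2 * alpha * ln T)))) in HET2; [|left; apply exp_pos].
    rewrite -!Rmult_assoc -!exp_plus in HET2.
    replace (- (2 * alpha * ln T) + 2 * alpha * ln T) with 0 in HET2 by ring.
    replace (- (2 * alpha * ln T) + 2 * alpha * ln t0) with (2 * alpha * ln t0 - 2 * alpha * ln T) in HET2 by ring.
    rewrite exp_0 in HET2. lra. }
  assert (H3 : exp (phi T) * (exp (2 * alpha * ln t0 - 2 * alpha * ln T) * E0 / 2) <= exp (alpha * ln t) * (2 * E t)).
  { apply Rle_trans with (exp (phi T) * G T); [|lra]. apply Rmult_le_compat_l; [left; apply exp_pos|lra]. }
  apply (Rmult_le_compat_l (exp (- alpha * ln t))) in H3; [|left; apply exp_pos].
  rewrite -(Rmult_assoc (exp (- alpha * ln t)) (exp (alpha * ln t))) -exp_plus in H3.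
  replace (- alpha * ln t + alpha * ln t) with 0 in H3 by ring. rewrite exp_0 in H3.
  unfold Rpower. lra.
Qed.

(** * Energy balance of the solution and conclusion *)

Lemma F_continuous {H : Hilbert} (B : Operator H) (hl : linear_operator B) (s : R) (F : H -> R)
    (gradF : H -> H) (hF : nonlinearity B s F gradF) (U : R -> H) (t : R) :
  (forall r, dom B (U r)) -> continuous U t -> continuous (fun r => B (U r)) t ->
  continuous (fun r => F (U r)) t.
Proof.
  intros Hdom HU HB. apply continuous_R_eps. intros eps Heps.
  destruct (gradF_continuous B hl s F gradF hF (U t) 1 (Hdom t) Rlt_0_1) as [d0 [Hd0 Hg]].
  set (K := norm (gradF (U t)) + 1).
  assert (HK : 0 < K) by (unfold K; pose proof (norm_pos_H (gradF (U t))); lra).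
  assert (He : 0 < Rmin d0 (eps / K)) by (apply Rmin_pos; [lra|now apply Rdiv_lt_0_compat]).
  destruct (proj1 (continuous_H_eps U t) HU _ He) as [d1 [Hd1 H1]].
  destruct (proj1 (continuous_H_eps _ t) HB d0 Hd0) as [d2 [Hd2 H2]].
  exists (Rmin d1 d2). split; [apply Rmin_pos; assumption|]. intros r Hr.
  pose proof (Rmin_l d1 d2). pose proof (Rmin_r d1 d2).
  pose proof (Rmin_l d0 (eps / K)). pose proof (Rmin_r d0 (eps / K)).
  specialize (H1 r ltac:(lra)). specialize (H2 r ltac:(lra)). simpl in H2.
  rewrite -(proj2 (dom_minus B hl _ _ (Hdom r) (Hdom t))) in H2.
  assert (Hex : exists d : H, d = minus (U r) (U t)) by (eexists; reflexivity). destruct Hex as [d Hd].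
  assert (Hdd : dom B d) by (rewrite Hd; apply (dom_minus B hl); apply Hdom).
  destruct (F_mean_value B hl s F gradF hF (U t) d (Hdom t) Hdd) as [c [Hc Hm]].
  replace (plus (U t) d) with (U r) in Hm by (rewrite Hd; vec_ring).
  rewrite Hm. rewrite -Hd in H1 H2.
  assert (Hgc : norm (minus (gradF (plus (U t) (scal c d))) (gradF (U t))) <= 1).
  { assert (Hx : minus (plus (U t) (scal c d)) (U t) = scal c d) by vec_ring.
    apply Hg.
    - apply dom_plus; [assumption|apply Hdom|]. apply dom_scal; assumption.
    - rewrite Hx. eapply Rle_trans; [apply norm_scal_H|]. rewrite Rabs_pos_eq; [|lra].
      pose proof (norm_pos_H d). nra.
    - rewrite Hx (app_scal _ hl); [|exact Hdd].
      eapply Rle_trans; [apply norm_scal_H|]. rewrite Rabs_pos_eq; [|lra].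
      pose proof (norm_pos_H (B d)). nra. }
  pose proof (norm_minus_le (gradF (plus (U t) (scal c d))) (gradF (U t))) as C1.
  eapply Rle_lt_trans; [apply cauchy_schwarz|].
  apply Rle_lt_trans with (K * norm d).
  - apply Rmult_le_compat_r; [apply norm_pos_H|]. unfold K. lra.
  - replace eps with (K * (eps / K)) by (field; lra). apply Rmult_lt_compat_l; lra.
Qed.

Lemma coercive_norm {H : Hilbert} (B : Operator H) (nu : R) (hnu : 0 < nu) (hc : coercive B nu) (v : H) :
  dom B v -> norm v ^ 2 <= / nu * norm (B v) ^ 2.
Proof.
  intros Hv. pose proof (hc v Hv) as Hn. apply (Rmult_le_reg_l nu); [exact hnu|].
  rewrite -Rmult_assoc Rinv_r; lra.
Qed.

Lemma weak_energy_balance {H : Hilbert} (A B : Operator H) (F : H -> R) (gradF : H -> H)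
    (s nu alpha t0 : R) (hA : self_adjoint A) (hA0 : nonneg_operator A) (hB : is_sqrt_operator A B)
    (hF : nonlinearity B s F gradF) (hnu : 0 < nu) (hcoer : coercive B nu) :
  exists Kp, 0 <= Kp /\ forall U V,
    weak_solution A B t0 U V (forcing gradF alpha t0 U V) ->
    energy_balance alpha t0 (/ sqrt nu) Kp ((s - 2) / 2)
      (fun t => inner (V t) (V t)) (fun t => inner (B (U t)) (B (U t))) (fun t => F (U t))
      (fun t => inner (V t) (U t)) (fun t => inner (gradF (U t)) (U t)).
Proof.
  pose proof (sa_linear _ (sqrt_self_adjoint _ _ hB)) as hl.
  destruct (inner_gradF_le B hl s F gradF hF) as [L1 [HL1 HL]].
  pose proof (s_gt_2 _ _ _ _ hF) as Hs. set (sigma := (s - 2) / 2). assert (Hsig : 0 < sigma) by (unfold sigma; lra).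
  pose proof (Rinv_0_lt_compat _ hnu) as Hinu.
  (* By coercivity $\|u\|_{\mathcal H_1}^2\le(1+1/\nu)\|A^{1/2}u\|^2\le K_2E$; raised to the power
     $\sigma=(s-2)/2$ this bounds the factor $\|u\|_{\mathcal H_1}^{s-2}$. *)
  set (K2 := 2 * (1 + / nu)). assert (HK2 : 0 < K2) by (unfold K2; lra).
  exists (L1 * K2 * Rpower K2 sigma). split.
  { apply Rmult_le_pos; [apply Rmult_le_pos; lra|left; apply exp_pos]. }
  intros U V hw. pose proof (weak_dom _ _ _ _ _ _ hw) as Hdom.
  assert (HF0 : forall t, 0 <= F (U t)) by (intros t; apply (F_nonneg _ _ _ _ hF), Hdom).
  assert (HE : forall t, t0 < t -> is_derive (fun r => inner (V r) (V r) / 2 + inner (B (U r)) (B (U r)) / 2 + F (U r)) t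
    (- (alpha / t) * inner (V t) (V t))).
  { intros t Ht.
    pose proof (is_derive_Rscal _ _ _ (/ 2) (energy_derive A B hA hA0 hB t0 U V _ hw t Ht)) as D1.
    pose proof (F_derive B hl s F gradF hF U t (V t) Hdom (weak_BU_continuous _ _ _ _ _ _ hw t)
      (weak_U_derive _ _ _ _ _ _ hw t Ht)) as D2.
    pose proof (is_derive_Rplus _ _ _ _ _ D1 D2) as D3.
    apply (is_derive_ext (fun r => / 2 * (inner (V r) (V r) + inner (B (U r)) (B (U r))) + F (U r))).
    { intros r. as_R_eq. field. }
    apply (is_derive_Rval _ _ _ _ D3). unfold forcing. rewrite (Rmax_right t0 t); [|lra].
    rewrite inner_plus_r inner_scal_r (inner_sym _ (gradF (U t))). lra. }
  constructor.
  - intros t _. apply inner_ge_0.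
  - intros t _. apply inner_ge_0.
  - intros t _. apply HF0.
  - intros t _. pose proof (coercive_norm B nu hnu hcoer (U t) (Hdom t)) as Hc.
    rewrite !inner_norm. specialize (HF0 t).
    pose proof (sqrt_lt_R0 nu hnu) as Hsq. pose proof (Rinv_0_lt_compat _ Hsq) as Hsi.
    assert (Hii : / sqrt nu * / sqrt nu = / nu).
    { rewrite -Rinv_mult sqrt_sqrt; [reflexivity|lra]. }
    assert (Hu : norm (U t) <= / sqrt nu * norm (B (U t))).
    { pose proof (norm_pos_H (U t)). pose proof (norm_pos_H (B (U t))).
      apply Rsqr_incr_0; [unfold Rsqr|assumption|apply Rmult_le_pos; lra].
      replace (/ sqrt nu * norm (B (U t)) * (/ sqrt nu * norm (B (U t))))
        with (/ sqrt nu * / sqrt nu * norm (B (U t)) ^ 2) by ring.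
      rewrite Hii. lra. }
    eapply Rle_trans; [apply cauchy_schwarz|].
    apply Rle_trans with (norm (V t) * (/ sqrt nu * norm (B (U t)))).
    { apply Rmult_le_compat_l; [apply norm_pos_H|exact Hu]. }
    replace (norm (V t) * (/ sqrt nu * norm (B (U t)))) with (/ sqrt nu * (norm (V t) * norm (B (U t)))) by ring.
    apply Rmult_le_compat_l; [lra|]. pose proof (pow2_ge_0 (norm (V t) - norm (B (U t)))). lra.
  - intros t _. pose proof (F_gradF _ _ _ _ hF (U t) (Hdom t)) as Hp. specialize (HF0 t). nra.
  - intros t m _ Hm HEm. rewrite !inner_norm in HEm |- *.
    set (E := norm (V t) ^ 2 / 2 + norm (B (U t)) ^ 2 / 2 + F (U t)) in *.
    pose proof (coercive_norm B nu hnu hcoer (U t) (Hdom t)) as Hc. specialize (HF0 t).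
    assert (Hb : norm (B (U t)) ^ 2 <= 2 * E) by (unfold E; pose proof (pow2_ge_0 (norm (V t))); lra).
    assert (HE0 : 0 <= E) by (pose proof (pow2_ge_0 (norm (B (U t)))); lra).
    pose proof (norm1_sq B (U t)) as Hn. pose proof (norm1_pos B (U t)) as Hn0.
    assert (Hn2 : norm1 B (U t) ^ 2 <= K2 * E).
    { rewrite Hn. apply Rle_trans with ((1 + / nu) * norm (B (U t)) ^ 2); [lra|].
      unfold K2. replace (2 * (1 + / nu) * E) with ((1 + / nu) * (2 * E)) by ring.
      apply Rmult_le_compat_l; lra. }
    assert (Hr : 0 <= rpow (norm1 B (U t)) (s - 2) <= Rpower K2 sigma * Rpower m sigma).
    { rewrite Rpower_mult_distr; try assumption.
      unfold rpow. destruct (Req_EM_T (norm1 B (U t)) 0) as [Hz|Hz].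
      - split; [lra|left; apply exp_pos].
      - split; [left; apply exp_pos|].
        replace (Rpower (norm1 B (U t)) (s - 2)) with (Rpower (norm1 B (U t) ^ 2) sigma).
        + apply Rle_Rpower_l; [lra|]. split; [apply pow_lt; lra|].
          apply Rle_trans with (1 := Hn2). apply Rmult_le_compat_l; lra.
        + rewrite -Rpower_pow; [|lra]. rewrite Rpower_mult. f_equal. unfold sigma. simpl. field. }
    apply Rle_trans with (1 := HL (U t) (Hdom t)).
    replace (L1 * K2 * Rpower K2 sigma * E * Rpower m sigma)
      with (L1 * (K2 * E) * (Rpower K2 sigma * Rpower m sigma)) by ring.
    apply Rmult_le_compat; [apply Rmult_le_pos; [lra|apply pow2_ge_0]|lra| |lra].
    apply Rmult_le_compat_l; lra.
  - intros t _.
    assert (Hc : forall f : R -> H, continuous f t -> continuous (fun r => inner (f r) (f r) / 2) t).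
    { intros f Hf. apply (continuous_mult (K := R_AbsRing) (fun r => inner (f r) (f r)) (fun _ => / 2)).
      - apply continuous_inner; exact Hf.
      - apply continuous_const. }
    apply (continuous_plus (fun r => inner (V r) (V r) / 2 + inner (B (U r)) (B (U r)) / 2) (fun r => F (U r))).
    + apply (continuous_plus (fun r => inner (V r) (V r) / 2) (fun r => inner (B (U r)) (B (U r)) / 2)).
      * apply Hc, hw.
      * apply (Hc (fun r => B (U r))), hw.
    (* Continuity is also required at [t0], where no derivative of [U] is provided. *)
    + apply (F_continuous B hl s F gradF hF); [exact Hdom|apply hw|apply hw].
  - exact HE.
  - intros t Ht. apply (is_derive_Rval _ _ _ _ (cross_derive A B hA hA0 hB t0 U V _ hw t Ht)).
    unfold forcing. rewrite (Rmax_right t0 t); [|lra]. rewrite inner_plus inner_scal. ring.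
Qed.

Theorem theorem3p5 (H : Hilbert) (A B : Operator H) (F : H -> R) (gradF : H -> H)
    (Sol dSol : R -> H -> H) (s nu alpha t0 : R)
    (hA : self_adjoint A) (hA0 : nonneg_operator A) (hB : is_sqrt_operator A B)
    (hF : nonlinearity B s F gradF)
    (hS : solution_operator A B Sol dSol)
    (hnu : 0 < nu) (hcoer : coercive B nu)
    (halpha : 0 < alpha) (ht0 : 0 < t0) :
  exists eps0 : R, 0 < eps0 /\
  forall eps : R, 0 < eps < eps0 ->
  forall t1 : R, t0 <= t1 ->
  (forall lambda : R, lambda = alpha / 2 \/ lambda = alpha / 2 + eps ->
     t1 ^ 2 >= Rmax (2 * lambda / nu * Rabs (alpha - 1))
                    (lambda / nu * Rabs (3 * lambda + 1 - alpha))) ->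
  forall t3 : R, 0 < t3 ->
  t3 ^ 2 >= (alpha / 2 + eps) * (1 + 2 * eps) / (2 * nu * eps)
              * Rabs (alpha - 2 - 2 * eps) + t1 ^ 2 ->
  t3 >= 2 * alpha * Rabs (alpha - 2) / nu + sqrt ((alpha + 2) / (3 * nu)) ->
  forall u0 u1 : H, dom B u0 -> ~ (u0 = zero /\ u1 = zero) ->
  exists t4 : R, t4 >= t3 /\
  forall u du : R -> H,
    mild_solution B gradF Sol dSol alpha t0 u0 u1 u du ->
    forall t : R, t >= t4 ->
      norm (du t) ^ 2 + norm (B (u t)) ^ 2 + F (u t)
        >= Rpower t4 (- alpha) / 4 * Rpower t0 (2 * alpha)
           * energy B F u du t0 * Rpower t (- alpha).
Proof.
  exists 1. split; [lra|]. intros eps _ t1 _ _ t3 Ht3 _ _ u0 u1 Hu0 _.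
  destruct (weak_energy_balance A B F gradF s nu alpha t0 hA hA0 hB hF hnu hcoer) as [Kp [HKp Heb]].
  (* The initial energy written in terms of the data, so that [T] and [C] are fixed before the
     solution is introduced. *)
  set (E0 := norm u1 ^ 2 / 2 + norm (B u0) ^ 2 / 2 + F u0).
  pose proof (F_nonneg _ _ _ _ hF u0 Hu0) as HF0.
  assert (HE0 : 0 <= E0) by (unfold E0; pose proof (pow2_ge_0 (norm u1)); pose proof (pow2_ge_0 (norm (B u0))); lra).
  pose proof (s_gt_2 _ _ _ _ hF) as Hs.
  destruct (energy_balance_lower_bound alpha t0 (/ sqrt nu) Kp ((s - 2) / 2) E0) as [T [C [HT [HC Hlow]]]];
    try assumption; try lra.
  { left. apply Rinv_0_lt_compat, sqrt_lt_R0, hnu. }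
  set (Y := Rpower t0 (2 * alpha)). assert (HY : 0 < Y) by apply exp_pos.
  (* The solution of $X^{-\alpha}Y/4=C$: for $t_4\ge X$ the constant of the claim is at most [C]. *)
  set (X := Rpower (4 * C / Y) (- / alpha)). assert (HX : 0 < X) by apply exp_pos.
  exists (Rmax t3 (Rmax T X)). set (t4 := Rmax t3 (Rmax T X)).
  assert (Hm1 : t3 <= t4) by apply Rmax_l.
  assert (Hm2 : T <= t4) by (eapply Rle_trans; [apply Rmax_l|apply Rmax_r]).
  assert (Hm3 : X <= t4) by (eapply Rle_trans; [apply Rmax_r|apply Rmax_r]).
  split; [lra|]. intros u du hm t Ht.
  destruct (mild_weak_solution A B F gradF Sol dSol s alpha t0 hA hA0 hB hF hS ht0 u0 u1 u du hm)
    as [hw [Hi0 Hi1]].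
  pose proof (Heb _ _ hw) as Hb. simpl in Hb.
  assert (HE : energy B F u du t0 = E0) by (unfold energy, E0; rewrite Hi0 Hi1; field).
  specialize (Hlow _ _ _ _ _ Hb).
  rewrite Rmax_left in Hlow; [|lra]. rewrite Hi0 Hi1 !inner_norm in Hlow.
  specialize (Hlow eq_refl t ltac:(lra)).
  rewrite Rmax_right in Hlow; [|lra]. rewrite !inner_norm in Hlow.
  assert (Hdt : 0 <= F (u t)) by (apply (F_nonneg _ _ _ _ hF), (mild_dom _ _ _ _ _ _ _ _ _ _ hm); lra).
  assert (H4 : Rpower t4 (- alpha) <= 4 * C / Y).
  { apply Rle_trans with (Rpower X (- alpha)).
    - unfold Rpower. apply exp_le_compat.
      assert (ln X <= ln t4).
      { destruct Hm3 as [Hlt|He]; [left; apply ln_increasing; assumption|right; now rewrite He]. }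
      nra.
    - unfold X. rewrite Rpower_mult. replace (- / alpha * - alpha) with 1 by (field; lra).
      rewrite Rpower_1; [apply Rle_refl|]. apply Rdiv_lt_0_compat; lra. }
  assert (H5 : Rpower t4 (- alpha) / 4 * Y <= C).
  { apply (Rmult_le_compat_r (Y / 4)) in H4; [|lra].
    replace (4 * C / Y * (Y / 4)) with C in H4 by (field; lra). lra. }
  rewrite HE. assert (H6 : 0 < Rpower t (- alpha)) by apply exp_pos.
  assert (H7 : Rpower t4 (- alpha) / 4 * Y * (E0 * Rpower t (- alpha)) <= C * (E0 * Rpower t (- alpha))).
  { apply Rmult_le_compat_r; [apply Rmult_le_pos; lra|exact H5]. }
  pose proof (pow2_ge_0 (norm (du t))). pose proof (pow2_ge_0 (norm (B (u t)))).
  lra.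
Qed.
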